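(* Let $k$ be a field of characteristic zero and let $\mathscr{U}\subseteq\mathscr{G}$ be a full, replete and widely closed subcategory such that the tensor unit of $\mathsf{D}(\mathscr{U})$ is compact, and suppose that $\mathscr{U}$ admits a profinite reflective filtration $\{\mathscr{U}[n]\}_{n\geq0}$. Then the profinite group prime map $$\pi_0\widehat{\mathscr{U}}\to\mathrm{Spc}(\mathsf{D}(\mathscr{U})^c),\qquad G\mapsto\mathfrak{p}_G=\Big\{X\in\mathsf{D}(\mathscr{U})^c\ \Big|\ \operatorname*{colim}_{N\in\mathcal{N}(G;\mathscr{U})}H_*(X)(G/N)=0\Big\},$$ is injective.
   Context: $\mathscr{G}$ is the category of finite groups with morphisms the conjugacy classes of surjective group homomorphisms. A full subcategory $\mathscr{U}\subseteq\mathscr{G}$ closed under isomorphism (replete) is widely closed if whenever $G\twoheadleftarrow H\twoheadrightarrow K$ are surjective homomorphisms with $G,H,K\in\mathscr{U}$, the image of $H\to G\times K$ lies in $\mathscr{U}$. $\pi_0$ denotes the set of isomorphism classes of objects. For a topologically finitely generated profinite group $G$, $\mathcal{N}(G;\mathscr{U})$ is the set of open normal subgroups $N$ with $G/N\in\mathscr{U}$. The profinite extension $\widehat{\mathscr{U}}$ is the category of topologically finitely generated profinite groups $G$ such that $\mathcal{N}(G;\mathscr{U})$ is cofinal among all open normal subgroups of $G$; morphisms are conjugacy classes of surjective (continuous) homomorphisms. A reflective filtration of $\mathscr{U}$ is a sequence of full replete subcategories $\mathscr{U}[0]\subseteq\mathscr{U}[1]\subseteq\cdots\subseteq\mathscr{U}$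 with $\bigcup_n\mathscr{U}[n]=\mathscr{U}$ such that each inclusion $\mathscr{U}[n]\to\mathscr{U}$ has a left adjoint. It is profinite if moreover each inclusion $\mathscr{U}[n]\to\widehat{\mathscr{U}}$ has a left adjoint. $\mathsf{D}(\mathscr{U})$ is the derived category of $\mathrm{Fun}(\mathscr{U}^{\mathrm{op}},\mathrm{Mod}_k)$, with the pointwise tensor product over $k$, and $\mathsf{D}(\mathscr{U})^c$ is its full subcategory of compact objects, an essentially small tensor-triangulated category under these hypotheses. $\mathrm{Spc}$ denotes the Balmer spectrum (space of prime thick ideals); each $\mathfrak{p}_G$ is a prime thick ideal. *)

(* Defs.v *)
From HB Require Import structures.
From mathcomp Require Import all_boot all_order all_algebra all_fingroup.
From mathcomp Require Import generic_quotient zify.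
From mathcomp Require Import all_classical.
From mathcomp Require Import topology.

Set Implicit Arguments.
Unset Strict Implicit.
Unset Printing Implicit Defensive.

Import GRing.Theory.
Local Open Scope classical_set_scope.
Local Open Scope ring_scope.
Local Open Scope quotient_scope.

(* Morphisms a -> b of a category are the elements of [hom a b] modulo [eqh]. *)

Record category := Category {
  ob :> Type;
  hom : ob -> ob -> Type;
  eqh : forall a b, hom a b -> hom a b -> Prop;
  idh : forall a, hom a a;
  comph : forall a b c, hom b c -> hom a b -> hom a c;
  eqh_refl : forall a b (f : hom a b), eqh f f;
  eqh_sym : forall a b (f g : hom a b), eqh f g -> eqh g f;
  eqh_trans : forall a b (f g h : hom a b), eqh f g -> eqh g h -> eqh f h;
  comph_eq : forall a b c (g g' : hom b c) (f f' : hom a b),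
    eqh g g' -> eqh f f' -> eqh (comph g f) (comph g' f');
  comph_idl : forall a b (f : hom a b), eqh (comph (idh b) f) f;
  comph_idr : forall a b (f : hom a b), eqh (comph f (idh a)) f;
  comphA : forall a b c d (h : hom c d) (g : hom b c) (f : hom a b),
    eqh (comph h (comph g f)) (comph (comph h g) f) }.

Arguments hom {c} _ _ : rename.
Arguments eqh {c a b} _ _ : rename.
Arguments idh {c} a : rename.
Arguments comph {c0 a b c} _ _ : rename.

Notation "f =h g" := (eqh f g) (at level 70, no associativity).
Notation "g \oh f" := (comph g f) (at level 50, left associativity).

Definition iso (C : category) (a b : C) : Prop :=
  exists (f : hom a b) (g : hom b a), g \oh f =h idh a /\ f \oh g =h idh b.

Definition replete (C : category) (P : C -> Prop) : Prop :=
  forall a b : C, iso a b -> P a -> P b.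

Definition fullsub (C : category) (P : C -> Prop) : category :=
  @Category {a : C | P a} (fun a b => hom (sval a) (sval b))
    (fun a b => @eqh C (sval a) (sval b)) (fun a => idh (sval a))
    (fun a b c => @comph C (sval a) (sval b) (sval c))
    (fun a b => @eqh_refl C (sval a) (sval b))
    (fun a b => @eqh_sym C (sval a) (sval b))
    (fun a b => @eqh_trans C (sval a) (sval b))
    (fun a b c => @comph_eq C (sval a) (sval b) (sval c))
    (fun a b => @comph_idl C (sval a) (sval b))
    (fun a b => @comph_idr C (sval a) (sval b))
    (fun a b c d => @comphA C (sval a) (sval b) (sval c) (sval d)).

Record functor (C D : category) := Functor {
  fob :> C -> D;
  fhom : forall a b, hom a b -> hom (fob a) (fob b);
  fhom_eq : forall a b (f g : hom a b), f =h g -> fhom f =h fhom g;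
  fhom_id : forall a, fhom (idh a) =h idh (fob a);
  fhom_comp : forall a b c (g : hom b c) (f : hom a b),
    fhom (g \oh f) =h fhom g \oh fhom f }.

Arguments fhom {C D} f0 {a b} _ : rename.

Definition has_left_adjoint (C D : category) (R : functor C D) : Prop :=
  exists (L : functor D C)
         (phi : forall (d : D) (c : C), hom (L d) c -> hom d (R c)),
    [/\ forall d c (f g : hom (L d) c), phi d c f =h phi d c g <-> f =h g,
        forall d c (h : hom d (R c)), exists f, phi d c f =h h,
        forall d c c' (g : hom c c') (f : hom (L d) c),
          phi d c' (g \oh f) =h fhom R g \oh phi d c f &
        forall d d' c (f : hom (L d) c) (u : hom d' d),
          phi d' c (f \oh fhom L u) =h phi d c f \oh u].

Definition pi0 (C : category) : Type :=
  {S : C -> Prop | exists a : C, S = iso a}.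

Definition pi0_class (C : category) (a : C) : pi0 C :=
  exist _ (iso a) (ex_intro _ a erefl).

Record epi (G H : groupType) := Epi {
  epi_fun :> G -> H;
  epiM : forall x y, epi_fun (x * y)%g = (epi_fun x * epi_fun y)%g;
  epi_surj : forall y, exists x, epi_fun x = y }.

Definition epi_conj (G H : groupType) (f g : epi G H) : Prop :=
  exists h : H, forall x, g x = (f x ^ h)%g.

Definition epi_id (G : groupType) : epi G G :=
  @Epi G G id (fun x y => erefl) (fun y => ex_intro _ y erefl).

Lemma comp_epiM (G H K : groupType) (g : epi H K) (f : epi G H) x y :
  (g \o f) (x * y)%g = ((g \o f) x * (g \o f) y)%g.
Proof. by rewrite /= !epiM. Qed.

Lemma comp_epi_surj (G H K : groupType) (g : epi H K) (f : epi G H) z :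
  exists x, (g \o f) x = z.
Proof.
have [y <-] := epi_surj g z; have [x <-] := epi_surj f y.
by exists x.
Qed.

Definition epi_comp (G H K : groupType) (g : epi H K) (f : epi G H) :
  epi G K := @Epi G K (g \o f) (@comp_epiM G H K g f) (@comp_epi_surj G H K g f).

Lemma epi1 (G H : groupType) (f : epi G H) : f 1%g = 1%g.
Proof. by apply: (@mulgI _ (f 1%g)); rewrite -epiM !mulg1. Qed.

Lemma epiJ (G H : groupType) (f : epi G H) x y : f (x ^ y)%g = (f x ^ f y)%g.
Proof.
rewrite /conjg !epiM; congr (_ * _)%g.
by apply: (@mulgI _ (f y)); rewrite -epiM !mulgV epi1.
Qed.

Section EpiConj.
Variables G H K : groupType.

Lemma epi_conj_refl (f : epi G H) : epi_conj f f.
Proof. by exists 1%g => x; rewrite conjg1. Qed.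

Lemma epi_conj_sym (f g : epi G H) : epi_conj f g -> epi_conj g f.
Proof. by case=> h fg; exists h^-1%g => x; rewrite fg conjgK. Qed.

Lemma epi_conj_trans (f g h : epi G H) :
  epi_conj f g -> epi_conj g h -> epi_conj f h.
Proof.
by case=> u fg [v gh]; exists (u * v)%g => x; rewrite gh fg conjgM.
Qed.

Lemma epi_conj_comp (g g' : epi H K) (f f' : epi G H) :
  epi_conj g g' -> epi_conj f f' -> epi_conj (epi_comp g f) (epi_comp g' f').
Proof.
case=> u gg' [v ff']; exists (g v * u)%g => x.
by rewrite /= gg' ff' epiJ conjgM.
Qed.

End EpiConj.

Definition finGrp : category :=
  @Category finGroupType (fun G H => epi G H) (fun G H => @epi_conj G H)
    (fun G => epi_id G) (fun G H K g f => epi_comp g f)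
    (fun G H => @epi_conj_refl G H) (fun G H => @epi_conj_sym G H)
    (fun G H => @epi_conj_trans G H)
    (fun G H K => @epi_conj_comp G H K)
    (fun G H f => epi_conj_refl f) (fun G H f => epi_conj_refl f)
    (fun G H K L h g f => epi_conj_refl (epi_comp (epi_comp h g) f)).

Definition widely_closed (U : finGrp -> Prop) : Prop :=
  forall (G H K : finGroupType) (f : epi H G) (g : epi H K),
    U G -> U H -> U K ->
    forall M : {group G * K},
      M = [set (f h, g h) | h in [set: H]]%SET :> {set G * K} ->
      U (subg_of M).

HB.mixin Record Group_isTopologicalGroup G of monoid.Group G & Topological G := {
  mulg_continuous : continuous (fun p : G * G => p.1 * p.2)%g;
  invg_continuous : continuous (fun x : G => x^-1)%g
}.

#[short(type="topologicalGroupType")]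
HB.structure Definition TopologicalGroup :=
  {G of monoid.Group G & Topological G & Group_isTopologicalGroup G}.

Record cepi (G H : topologicalGroupType) := Cepi {
  cepi_epi :> epi G H;
  cepi_continuous : continuous (cepi_epi : G -> H) }.

Definition cepi_id (G : topologicalGroupType) : cepi G G :=
  @Cepi G G (epi_id G) (fun x => cvg_id).

Lemma cepi_comp_continuous (G H K : topologicalGroupType) (g : cepi H K)
  (f : cepi G H) : continuous (epi_comp g f : G -> K).
Proof.
move=> x; apply: (@continuous_comp _ _ _ f g).
  exact: cepi_continuous.
exact: cepi_continuous.
Qed.

Definition cepi_comp (G H K : topologicalGroupType) (g : cepi H K)
  (f : cepi G H) : cepi G K :=
  @Cepi G K (epi_comp g f) (@cepi_comp_continuous G H K g f).

Definition topGrp : category :=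
  @Category topologicalGroupType (fun G H => cepi G H)
    (fun G H f g => epi_conj f g)
    (fun G => cepi_id G) (fun G H K g f => cepi_comp g f)
    (fun G H f => epi_conj_refl f) (fun G H f g => @epi_conj_sym G H f g)
    (fun G H f g h => @epi_conj_trans G H f g h)
    (fun G H K g g' f f' => @epi_conj_comp G H K g g' f f')
    (fun G H f => epi_conj_refl f) (fun G H f => epi_conj_refl f)
    (fun G H K L h g f => epi_conj_refl (epi_comp (epi_comp h g) f)).

Section Profinite.
Variables (U : finGrp -> Prop) (G : topologicalGroupType).

Definition profinite : Prop :=
  [/\ compact [set: G], hausdorff_space G & totally_disconnected [set: G]].

Definition is_subgroup (N : set G) : Prop :=
  [/\ N 1%g, forall x y, N x -> N y -> N (x * y)%g &
      forall x, N x -> N (x^-1)%g].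

Definition is_normal (N : set G) : Prop :=
  is_subgroup N /\ forall x y, N x -> N (x ^ y)%g.

Definition topologically_fg : Prop :=
  exists s : seq G, dense (smallest is_subgroup [set` s]).

(* A quotient group G/N that lies in U: a group [fq_ob] of U together with a
   surjection from G with kernel N. *)
Record fquotient (N : set G) := FQuotient {
  fq_ob : fullsub U;
  fq_proj : epi G (sval fq_ob);
  fq_ker : forall x, N x <-> fq_proj x = 1%g }.

Definition NN (N : set G) : Prop :=
  [/\ open N, is_normal N & inhabited (fquotient N)].

(* G/N, determined up to a unique isomorphism under G. *)
Definition quo (N : {N | NN N}) : fquotient (sval N) :=
  let: And3 _ _ h := proj2_sig N in inhabited_witness h.

Definition in_profinite_extension : Prop :=
  [/\ profinite, topologically_fg &
      forall M : set G, open M -> is_normal M ->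
        exists2 N : set G, NN N & N `<=` M].

End Profinite.

Definition profinite_extension (U : finGrp -> Prop) : category :=
  @fullsub topGrp (in_profinite_extension U).

HB.instance Definition _ (G : finGroupType) :=
  monoid.Group.copy (discrete_topology G) G.

Section Discrete.
Variable G : finGroupType.
Let D := discrete_topology G.

Lemma discrete_mulg : continuous (fun p : D * D => p.1 * p.2)%g.
Proof.
move=> [x y] A /= Axy; exists ([set x], [set y]) => /=.
  by split; exact: discrete_set1.
by move=> [u v] /= [-> ->]; exact: nbhs_singleton Axy.
Qed.

Lemma discrete_continuous (T : topologicalType) (f : D -> T) : continuous f.
Proof.
move=> x A Ax; have : nbhs x [set x] by exact: discrete_set1.
by apply: (filterS (F := nbhs x)) => _ ->; exact: nbhs_singleton Ax.
Qed.

HB.instance Definition _ :=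
  Group_isTopologicalGroup.Build (discrete_topology G) discrete_mulg
    (@discrete_continuous D (fun x => x^-1)%g).

End Discrete.

Definition discrete_group (G : finGroupType) : topologicalGroupType :=
  discrete_topology G.

Section DiscreteExtension.
Variable U : finGrp -> Prop.

Lemma discrete_in_extension (G : finGroupType) :
  U G -> in_profinite_extension U (discrete_group G).
Proof.
move=> UG; pose D := discrete_group G.
have finD : finite_set [set: D] by exact: (@finite_finset G).
split.
- split; first exact: finite_compact.
    exact: discrete_hausdorff.
  apply: zero_dimension_totally_disconnected; exact: discrete_zero_dimension.
- exists (enum G : seq D) => O [x Ox] _; exists x; split=> //.
  by move=> A [_ /(_ x)]; apply; rewrite /= mem_enum.
- move=> M oM [[M1 _ _] _]; exists [set 1%g : D]; last by move=> _ ->.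
  split; first exact: discrete_open.
    split; first split => //.
    + by move=> x y -> ->; rewrite mulg1.
    + by move=> x ->; rewrite invg1.
    by move=> x y ->; rewrite conj1g.
  by constructor; exists (exist _ G UG) (epi_id G).
Qed.

Variables (V : finGrp -> Prop) (VU : forall G, V G -> U G).

Definition subcat_inclusion : functor (fullsub V) (fullsub U) :=
  @Functor (fullsub V) (fullsub U)
    (fun G => exist _ (sval G) (VU (proj2_sig G)))
    (fun G H f => f) (fun G H f g fg => fg)
    (fun G => @epi_conj_refl _ _ _) (fun G H K g f => @epi_conj_refl _ _ _).

Definition profinite_inclusion : functor (fullsub V) (profinite_extension U) :=
  @Functor (fullsub V) (profinite_extension U)
    (fun G => exist _ (discrete_group (sval G))
                (discrete_in_extension (VU (proj2_sig G))))
    (fun G H f => @Cepi (discrete_group (sval G)) (discrete_group (sval H)) f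
       (@discrete_continuous (sval G) (discrete_group (sval H)) f))
    (fun G H f g fg => fg)
    (fun G => @epi_conj_refl _ _ _) (fun G H K g f => @epi_conj_refl _ _ _).

End DiscreteExtension.

Record profinite_reflective_filtration (U : finGrp -> Prop)
    (V : nat -> finGrp -> Prop) : Prop := {
  prf_replete : forall n, replete (V n);
  prf_mono : forall n G, V n G -> V n.+1 G;
  prf_sub : forall n G, V n G -> U G;
  prf_union : forall G, U G -> exists n, V n G;
  prf_reflective : forall n, has_left_adjoint (subcat_inclusion (@prf_sub n));
  prf_profinite : forall n,
    has_left_adjoint (profinite_inclusion (@prf_sub n)) }.

Definition mklin (k : fieldType) (V W : lmodType k) (f : V -> W)
    (f_lin : linear f) : {linear V -> W} :=
  HB.pack f (GRing.isLinear.Build k V W *:%R f f_lin).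

(* The k-module with generators S and relations r = 0 for r in Rel, where a
   formal sum of generators is a list of pairs (coefficient, generator).  Two
   formal sums are identified when every map from S to a k-module which kills
   the relators takes the same value on both. *)
Section Presentation.
Variables (k : fieldType) (S : Type).
Implicit Types (s t : seq (k * S)).

Definition fsum (W : lmodType k) (f : S -> W) s : W :=
  \sum_(p <- s) p.1 *: f p.2.

Variable Rel : seq (k * S) -> Prop.

Definition kills (W : lmodType k) (f : S -> W) : Prop :=
  forall r, Rel r -> fsum f r = 0.

Definition fsum_eq (s t : {classic seq (k * S)}) : bool :=
  `[< forall (W : lmodType k) (f : S -> W), kills f -> fsum f s = fsum f t >].

Lemma fsum_eq_refl : reflexive fsum_eq.
Proof. by move=> s; apply/asboolP. Qed.

Lemma fsum_eq_sym : symmetric fsum_eq.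
Proof.
by move=> s t; apply/asboolP/asboolP => h W f fR; rewrite (h W f fR).
Qed.

Lemma fsum_eq_trans : transitive fsum_eq.
Proof.
move=> t s u /asboolP st /asboolP tu; apply/asboolP => W f fR.
by rewrite (st W f fR) (tu W f fR).
Qed.

Canonical fsum_eqv : equiv_rel {classic seq (k * S)} :=
  EquivRel fsum_eq fsum_eq_refl fsum_eq_sym fsum_eq_trans.

Definition pres : Type := {eq_quot fsum_eqv}.

HB.instance Definition _ := Choice.on pres.

Definition pres_of s : pres := \pi_({eq_quot fsum_eqv}) (s : {classic _}).
Definition pres_repr (u : pres) : seq (k * S) :=
  repr (u : {eq_quot fsum_eqv}).

Definition pres_ev (W : lmodType k) (f : S -> W) (u : pres) : W :=
  fsum f (pres_repr u).

Lemma pres_eqP (u v : pres) :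
  (forall (W : lmodType k) (f : S -> W), kills f -> pres_ev f u = pres_ev f v)
  -> u = v.
Proof.
move=> h; rewrite -[u](@reprK _ {eq_quot fsum_eqv}).
rewrite -[v](@reprK _ {eq_quot fsum_eqv}).
by apply/eqmodP/asboolP => W f fR; exact: h.
Qed.

Lemma pres_evE (W : lmodType k) (f : S -> W) s :
  kills f -> pres_ev f (pres_of s) = fsum f s.
Proof.
move=> fR; suff /eqmodP/asboolP/(_ W f fR) : pres_repr (pres_of s) = s
  %[mod {eq_quot fsum_eqv}] by [].
exact: (@reprK _ {eq_quot fsum_eqv}).
Qed.

Definition pres_zero : pres := pres_of [::].
Definition pres_add (u v : pres) : pres :=
  pres_of (pres_repr u ++ pres_repr v).
Definition pres_scale (a : k) (u : pres) : pres :=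
  pres_of [seq (a * p.1, p.2) | p <- pres_repr u].

Section Ev.
Variables (W : lmodType k) (f : S -> W) (fR : kills f).

Lemma pres_ev0 : pres_ev f pres_zero = 0.
Proof. by rewrite pres_evE// /fsum big_nil. Qed.

Lemma pres_evD u v : pres_ev f (pres_add u v) = pres_ev f u + pres_ev f v.
Proof. by rewrite pres_evE// /fsum big_cat. Qed.

Lemma pres_evZ a u : pres_ev f (pres_scale a u) = a *: pres_ev f u.
Proof.
rewrite pres_evE// /fsum big_map scaler_sumr.
by apply: eq_bigr => p _; rewrite /= scalerA.
Qed.

End Ev.

Let evE := (pres_ev0, pres_evD, pres_evZ).

Fact pres_addA : associative pres_add.
Proof. by move=> u v w; apply: pres_eqP => W f fR; rewrite !evE// addrA. Qed.
Fact pres_addC : commutative pres_add.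
Proof. by move=> u v; apply: pres_eqP => W f fR; rewrite !evE// addrC. Qed.
Fact pres_add0 : left_id pres_zero pres_add.
Proof. by move=> u; apply: pres_eqP => W f fR; rewrite !evE// add0r. Qed.
Fact pres_addN : left_inverse pres_zero (pres_scale (-1)) pres_add.
Proof.
by move=> u; apply: pres_eqP => W f fR; rewrite !evE// scaleN1r addNr.
Qed.

HB.instance Definition _ :=
  GRing.isZmodule.Build pres pres_addA pres_addC pres_add0 pres_addN.

Fact pres_scaleA a b u : pres_scale a (pres_scale b u) = pres_scale (a * b) u.
Proof. by apply: pres_eqP => W f fR; rewrite !evE// scalerA. Qed.
Fact pres_scale1 : left_id 1 pres_scale.
Proof. by move=> u; apply: pres_eqP => W f fR; rewrite !evE// scale1r. Qed.
Fact pres_scaleDr : right_distributive pres_scale +%R.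
Proof. by move=> a u v; apply: pres_eqP => W f fR; rewrite !evE// scalerDr. Qed.
Fact pres_scaleDl u : {morph pres_scale^~ u : a b / a + b}.
Proof. by move=> a b; apply: pres_eqP => W f fR; rewrite !evE// scalerDl. Qed.

HB.instance Definition _ := GRing.Zmodule_isLmodule.Build k pres
  pres_scaleA pres_scale1 pres_scaleDr pres_scaleDl.

Definition pgen (x : S) : pres := pres_of [:: (1, x)].

Lemma pres_ev_linear (W : lmodType k) (f : S -> W) :
  kills f -> linear (pres_ev f).
Proof. by move=> fR a u v; rewrite [LHS]pres_evD// [X in X + _]pres_evZ. Qed.

Definition plift (W : lmodType k) (f : S -> W) (fR : kills f) :
  {linear pres -> W} := mklin (pres_ev_linear fR).

Lemma plift_gen (W : lmodType k) (f : S -> W) (fR : kills f) x :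
  plift fR (pgen x) = f x.
Proof. by rewrite /= pres_evE// /fsum big_seq1 scale1r. Qed.

Lemma pres_ofE s : pres_of s = fsum pgen s.
Proof.
apply: pres_eqP => W f fR; rewrite pres_evE// -[RHS]/(plift fR _).
rewrite /fsum linear_sum; apply: eq_bigr => p _.
by rewrite linearZ plift_gen.
Qed.

Lemma pres_ext (W : lmodType k) (f g : {linear pres -> W}) :
  (forall x, f (pgen x) = g (pgen x)) -> f =1 g.
Proof.
move=> fg u; rewrite -[u](@reprK _ {eq_quot fsum_eqv}).
rewrite -/(pres_of (pres_repr u)) pres_ofE /fsum !linear_sum.
by apply: eq_bigr => p _; rewrite !linearZ fg.
Qed.

Lemma pgen_kills : kills pgen.
Proof.
move=> r rR; rewrite -pres_ofE; apply: pres_eqP => W f fR.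
by rewrite pres_evE// pres_ev0// fR.
Qed.

End Presentation.

Arguments plift : simpl never.

(* The relators z - a x - y, x - y and x. *)
Section Relators.
Variables (k : fieldType) (S : Type).

Definition lin_relator (a : k) (z x y : S) : seq (k * S) :=
  [:: (1, z); (- a, x); (-1, y)].
Definition eq_relator (x y : S) : seq (k * S) := [:: (1, x); (-1, y)].
Definition zero_relator (x : S) : seq (k * S) := [:: (1, x)].

Variables (W : lmodType k) (f : S -> W).

Lemma fsum_lin a z x y :
  f z = a *: f x + f y <-> fsum f (lin_relator a z x y) = 0.
Proof.
rewrite /fsum /lin_relator !big_cons big_nil /= addr0 scale1r !scaleNr scale1r.
by rewrite -opprD; split=> [->|/eqP]; rewrite ?subrr// subr_eq0 => /eqP.
Qed.

Lemma fsum_eqr x y : f x = f y <-> fsum f (eq_relator x y) = 0.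
Proof.
rewrite /fsum /eq_relator !big_cons big_nil /= addr0 scale1r scaleN1r.
by split=> [->|/eqP]; rewrite ?subrr// subr_eq0 => /eqP.
Qed.

Lemma fsum_zero x : f x = 0 <-> fsum f (zero_relator x) = 0.
Proof. by rewrite /fsum big_seq1 scale1r. Qed.

End Relators.

(* Colimit of the modules (V i)_i along the linear maps selected by T; with no
   such maps this is the direct sum. *)
Section Colimit.
Variables (k : fieldType) (I : Type) (V : I -> lmodType k).
Variable T : forall i j, {linear V i -> V j} -> Prop.

Inductive colim_rel : seq (k * {i & V i}) -> Prop :=
| colim_lin i (a : k) (x y : V i) : colim_rel (lin_relator a
    (existT _ i (a *: x + y)) (existT _ i x) (existT _ i y))
| colim_transition i j (t : {linear V i -> V j}) (x : V i) : T t ->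
    colim_rel (eq_relator k (existT _ i x) (existT _ j (t x))).

Definition colim : lmodType k := pres colim_rel.
Definition colim_in i (x : V i) : colim := pgen colim_rel (existT _ i x).

Lemma colim_in_linear i : linear (@colim_in i).
Proof. move=> a x y; apply/(fsum_lin (pgen colim_rel)); apply: pgen_kills.
exact: colim_lin. Qed.

End Colimit.

Definition no_transition (k : fieldType) (I : Type) (V : I -> lmodType k) i j
  (t : {linear V i -> V j}) : Prop := False.

Definition dirsum (k : fieldType) (I : Type) (V : I -> lmodType k) :
  lmodType k := colim (@no_transition k I V).

Section Presheaves.
Variables (k : fieldType) (C : category).

Record presheaf := Presheaf {
  pob :> C -> lmodType k;
  pmap : forall a b, hom a b -> {linear pob b -> pob a};
  pmap_eq : forall a b (f g : hom a b), f =h g -> pmap f =1 pmap g;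
  pmap_id : forall a, pmap (idh a) =1 id;
  pmap_comp : forall a b c (g : hom b c) (f : hom a b),
    pmap (g \oh f) =1 pmap f \o pmap g }.

Arguments pmap F {a b} f : rename.

Record psh_map (F G : presheaf) := PshMap {
  pm :> forall a, {linear F a -> G a};
  pm_nat : forall a b (f : hom a b) x, pm a (pmap F f x) = pmap G f (pm b x) }.

Definition const_psh (V : lmodType k) : presheaf :=
  @Presheaf (fun=> V) (fun _ _ _ => idfun) (fun _ _ _ _ _ _ => erefl)
    (fun _ _ => erefl) (fun _ _ _ _ _ _ => erefl).

Definition pm_id (F : presheaf) : psh_map F F :=
  @PshMap F F (fun a => idfun) (fun a b f x => erefl).

Lemma pm_comp_nat (F G H : presheaf) (v : psh_map G H) (u : psh_map F G)
  a b (f : hom a b) x : (v a \o u a) (pmap F f x) = pmap H f ((v b \o u b) x).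
Proof. by rewrite /= !pm_nat. Qed.

Definition pm_comp (F G H : presheaf) (v : psh_map G H) (u : psh_map F G) :
  psh_map F H :=
  @PshMap F H (fun a => v a \o u a) (@pm_comp_nat F G H v u).

Lemma pm_zero_nat (F G : presheaf) a b (f : hom a b) (x : F b) :
  \0 (pmap F f x) = pmap G f (\0 x).
Proof. by rewrite linear0. Qed.

Definition pm_zero (F G : presheaf) : psh_map F G :=
  @PshMap F G (fun a => \0) (@pm_zero_nat F G).

Lemma pm_add_nat (F G : presheaf) (u v : psh_map F G) a b (f : hom a b) x :
  (u a \+ v a) (pmap F f x) = pmap G f ((u b \+ v b) x).
Proof. by rewrite /= !pm_nat linearD. Qed.

Definition pm_add (F G : presheaf) (u v : psh_map F G) : psh_map F G :=
  @PshMap F G (fun a => u a \+ v a) (@pm_add_nat F G u v).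

(* Unbounded chain complexes. The differential X_i -> X_j is given for all
   pairs (i, j) and vanishes unless i = j + 1. *)

Record complex := Complex {
  cx :> int -> presheaf;
  cd : forall i j, psh_map (cx i) (cx j);
  cd_shape : forall i j a x, i <> j + 1 -> cd i j a x = 0;
  cd_cd : forall i j l a x, cd j l a (cd i j a x) = 0 }.

Arguments cd X i j : rename.

Record cmap (X Y : complex) := Cmap {
  cm :> forall n, psh_map (X n) (Y n);
  cm_cd : forall i j a x, cm j a (cd X i j a x) = cd Y i j a (cm i a x) }.

Definition cm_id (X : complex) : cmap X X :=
  @Cmap X X (fun n => pm_id (X n)) (fun i j a x => erefl).

Lemma cm_comp_cd (X Y Z : complex) (g : cmap Y Z) (f : cmap X Y) i j a x :
  pm_comp (g j) (f j) a (cd X i j a x) = cd Z i j a (pm_comp (g i) (f i) a x).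
Proof. by rewrite /= !cm_cd. Qed.

Definition cm_comp (X Y Z : complex) (g : cmap Y Z) (f : cmap X Y) :
  cmap X Z := @Cmap X Z (fun n => pm_comp (g n) (f n)) (cm_comp_cd g f).

Lemma cm_zero_cd (X Y : complex) i j a (x : X i a) :
  pm_zero (X j) (Y j) a (cd X i j a x)
  = cd Y i j a (pm_zero (X i) (Y i) a x).
Proof. by rewrite /= linear0. Qed.

Definition cm_zero (X Y : complex) : cmap X Y :=
  @Cmap X Y (fun n => pm_zero (X n) (Y n)) (@cm_zero_cd X Y).

Lemma cm_add_cd (X Y : complex) (f g : cmap X Y) i j a x :
  pm_add (f j) (g j) a (cd X i j a x) = cd Y i j a (pm_add (f i) (g i) a x).
Proof. by rewrite /= !cm_cd linearD. Qed.

Definition cm_add (X Y : complex) (f g : cmap X Y) : cmap X Y :=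
  @Cmap X Y (fun n => pm_add (f n) (g n)) (cm_add_cd f g).

Section Homology.
Variables (X : complex) (n : int).

Definition cycle (a : C) : Type := {x : X n a | forall j, cd X n j a x = 0}.

Inductive homology_rel a : seq (k * cycle a) -> Prop :=
| homology_lin c (z x y : cycle a) : sval z = c *: sval x + sval y ->
    homology_rel (lin_relator c z x y)
| homology_bound i y (z : cycle a) : sval z = cd X i n a y ->
    homology_rel (zero_relator k z).

Definition homology_mod a : lmodType k := pres (@homology_rel a).

Lemma pmap_cycle a b (f : hom a b) (z : cycle b) j :
  cd X n j a (pmap (X n) f (sval z)) = 0.
Proof. by rewrite pm_nat (proj2_sig z) linear0. Qed.

Definition cycle_pmap a b (f : hom a b) (z : cycle b) : cycle a :=
  exist _ (pmap (X n) f (sval z)) (pmap_cycle f z).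

Lemma homology_pmap_kills a b (f : hom a b) :
  kills (@homology_rel b) (fun z => pgen (@homology_rel a) (cycle_pmap f z)).
Proof.
move=> _ [c z x y zE|i y z zE].
- apply/fsum_lin/(fsum_lin (pgen _)); apply: pgen_kills.
  apply: homology_lin.
  by rewrite /= zE linearP.
- apply: (proj1 (fsum_zero _ _)); apply: (proj2 (fsum_zero (pgen _) _)).
  apply: pgen_kills.
  apply: (@homology_bound _ i (pmap (X i) f y)).
  by rewrite /= zE pm_nat.
Qed.

Definition homology_pmap a b (f : hom a b) :
  {linear homology_mod b -> homology_mod a} := plift (homology_pmap_kills f).

Lemma cycle_inj a (x y : cycle a) : sval x = sval y -> x = y.
Proof. by case: x y => x hx [y hy] /= xy; apply: eq_exist. Qed.

Lemma homology_pmap_eq a b (f g : hom a b) :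
  f =h g -> homology_pmap f =1 homology_pmap g.
Proof.
move=> fg; apply: pres_ext => z; rewrite !plift_gen; congr pgen.
by apply: cycle_inj; exact: pmap_eq.
Qed.

Lemma homology_pmap_id a : homology_pmap (idh a) =1 id.
Proof.
apply: (@pres_ext _ _ _ _ _ idfun) => z; rewrite plift_gen; congr pgen.
by apply: cycle_inj; exact: pmap_id.
Qed.

Lemma homology_pmap_comp a b c (g : hom b c) (f : hom a b) :
  homology_pmap (g \oh f) =1 homology_pmap f \o homology_pmap g.
Proof.
apply: (@pres_ext _ _ _ _ _ (homology_pmap f \o homology_pmap g)) => z.
rewrite -[RHS]/(homology_pmap f (homology_pmap g _)) !plift_gen.
congr pgen.
by apply: cycle_inj; exact: pmap_comp.
Qed.

Definition homology : presheaf :=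
  @Presheaf homology_mod homology_pmap homology_pmap_eq homology_pmap_id
    homology_pmap_comp.

End Homology.

Section HomologyMap.
Variables (X Y : complex) (f : cmap X Y) (n : int).

Lemma cm_cycle a (z : cycle X n a) j : cd Y n j a (f n a (sval z)) = 0.
Proof. by rewrite -cm_cd (proj2_sig z) linear0. Qed.

Definition cycle_map a (z : cycle X n a) : cycle Y n a :=
  exist _ (f n a (sval z)) (cm_cycle z).

Lemma homology_map_kills a : kills (@homology_rel X n a)
  (fun z => pgen (@homology_rel Y n a) (cycle_map z)).
Proof.
move=> _ [c z x y zE|i y z zE].
- apply/fsum_lin/(fsum_lin (pgen _)); apply: pgen_kills.
  apply: homology_lin.
  by rewrite /= zE linearP.
- apply: (proj1 (fsum_zero _ _)); apply: (proj2 (fsum_zero (pgen _) _)).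
  apply: pgen_kills.
  apply: (@homology_bound _ _ _ i (f i a y)).
  by rewrite /= zE cm_cd.
Qed.

Definition homology_map a : {linear homology X n a -> homology Y n a} :=
  plift (@homology_map_kills a).

End HomologyMap.

Definition quasi_iso (X Y : complex) (f : cmap X Y) : Prop :=
  forall n a, bijective (homology_map f n a).

Section DirectSum.
Variables (I : Type) (Y : I -> complex).

Definition sum_mod n a : lmodType k := dirsum (fun i => Y i n a).
Definition sum_in n a i (x : Y i n a) : sum_mod n a :=
  @colim_in _ _ (fun i => Y i n a) (@no_transition _ _ _) i x.

Section SumLift.
Variables (n m : int) (a b : C)
  (u : forall i, {linear Y i n a -> Y i m b}).

Lemma sum_lift_kills : kills (@colim_rel _ _ _ (@no_transition _ I _))
  (fun p : {i & Y i n a} => sum_in (u (projT1 p) (projT2 p))).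
Proof.
move=> _ [i c x y|i j t x []]; apply/fsum_lin.
by rewrite /= linearP; exact: colim_in_linear.
Qed.

Definition sum_lift : {linear sum_mod n a -> sum_mod m b} :=
  plift sum_lift_kills.

Lemma sum_liftE i x : sum_lift (@sum_in n a i x) = sum_in (u i x).
Proof. exact: plift_gen. Qed.

End SumLift.

Lemma sum_ext n a (W : lmodType k) (f g : {linear sum_mod n a -> W}) :
  (forall i x, f (@sum_in n a i x) = g (@sum_in n a i x)) -> f =1 g.
Proof. by move=> fg; apply: pres_ext => -[i x]; exact: fg. Qed.

Definition sum_pmap n a b (f : hom a b) := sum_lift (fun i => pmap (Y i n) f).

Lemma sum_pmap_eq n a b (f g : hom a b) :
  f =h g -> sum_pmap n f =1 sum_pmap n g.
Proof.
move=> fg; apply: sum_ext => i x; rewrite !sum_liftE.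
by congr sum_in; exact: pmap_eq.
Qed.

Lemma sum_pmap_id n a : sum_pmap n (idh a) =1 id.
Proof. by apply: (@sum_ext _ _ _ _ idfun) => i x; rewrite sum_liftE pmap_id. Qed.

Lemma sum_pmap_comp n a b c (g : hom b c) (f : hom a b) :
  sum_pmap n (g \oh f) =1 sum_pmap n f \o sum_pmap n g.
Proof.
apply: (@sum_ext _ _ _ _ (sum_pmap n f \o sum_pmap n g)) => i x.
by rewrite -[RHS]/(sum_pmap n f (sum_pmap n g _)) !sum_liftE pmap_comp.
Qed.

Definition sum_psh n : presheaf :=
  @Presheaf (sum_mod n) (@sum_pmap n) (@sum_pmap_eq n) (@sum_pmap_id n)
    (@sum_pmap_comp n).

Lemma sum_cd_nat i j a b (f : hom a b) x :
  sum_lift (fun l => cd (Y l) i j a) (pmap (sum_psh i) f x)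
  = pmap (sum_psh j) f (sum_lift (fun l => cd (Y l) i j b) x).
Proof.
pose d c := sum_lift (fun l => cd (Y l) i j c).
move: x; apply: (@sum_ext _ _ _ (d a \o sum_pmap i f) (sum_pmap j f \o d b)).
move=> l x.
rewrite -[LHS]/(sum_lift _ (sum_pmap i f _)).
by rewrite -[RHS]/(sum_pmap j f (sum_lift _ _)) !sum_liftE pm_nat.
Qed.

Definition sum_cd i j : psh_map (sum_psh i) (sum_psh j) :=
  @PshMap (sum_psh i) (sum_psh j) (fun a => sum_lift (fun l => cd (Y l) i j a))
    (@sum_cd_nat i j).

Lemma sum_in0 n a i : @sum_in n a i 0 = 0.
Proof.
have := @colim_in_linear k I (fun i => Y i n a) (@no_transition _ _ _) i.
by move=> /(_ (-1) 0 0); rewrite scaler0 addr0 scaleN1r addNr.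
Qed.

Lemma sum_cd_shape i j a x : i <> j + 1 -> sum_cd i j a x = 0.
Proof.
move=> ij; move: x; apply: (@sum_ext _ _ _ _ \0) => l x.
by rewrite -[LHS]/(sum_lift _ _) sum_liftE cd_shape// sum_in0.
Qed.

Lemma sum_cd_cd i j l a x : sum_cd j l a (sum_cd i j a x) = 0.
Proof.
move: x; apply: (@sum_ext _ _ _ (sum_cd j l a \o sum_cd i j a) \0) => p x.
by rewrite -[LHS]/(sum_lift _ (sum_lift _ _)) !sum_liftE cd_cd sum_in0.
Qed.

Definition sum_complex : complex := Complex sum_cd_shape sum_cd_cd.

Lemma sum_in_pmap i n a b (f : hom a b) x :
  mklin (@colim_in_linear _ _ _ (@no_transition _ I (fun i => Y i n a)) i)
    (pmap (Y i n) f x)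
  = pmap (sum_psh n) f
    (mklin (@colim_in_linear _ _ _ (@no_transition _ I (fun i => Y i n b)) i)
      x).
Proof. by rewrite -[RHS]/(sum_pmap n f (sum_in _)) sum_liftE. Qed.

Definition sum_in_psh i n : psh_map (Y i n) (sum_complex n) :=
  @PshMap (Y i n) (sum_complex n) _ (@sum_in_pmap i n).

Lemma sum_in_cd l i j a x :
  sum_in_psh l j a (cd (Y l) i j a x)
  = cd sum_complex i j a (sum_in_psh l i a x).
Proof. by rewrite -[RHS]/(sum_lift _ (sum_in _)) sum_liftE. Qed.

Definition sum_incl i : cmap (Y i) sum_complex :=
  @Cmap (Y i) sum_complex (sum_in_psh i) (@sum_in_cd i).

End DirectSum.

(* The mapping cone: X_(n-1) + Y_n in degree n, with differential
   (x, y) |-> (- d x, f x + d y). *)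

Section Cone.

Definition pair_fun (V V' W W' : lmodType k) (u : {linear V -> V'})
    (v : {linear V -> W'}) (w : {linear W -> W'}) (p : V * W) : V' * W' :=
  (u p.1, v p.1 + w p.2).

Lemma pair_fun_linear (V V' W W' : lmodType k) u v w :
  linear (@pair_fun V V' W W' u v w).
Proof.
move=> c p q; rewrite /pair_fun !linearP; congr pair => /=.
by rewrite scalerDr addrACA.
Qed.

Definition pair_lin (V V' W W' : lmodType k) u v w :
  {linear (V * W)%type -> (V' * W')%type} :=
  mklin (@pair_fun_linear V V' W W' u v w).

Variables F G : presheaf.

Definition prod_pmap a b (f : hom a b) :
    {linear (F b * G b)%type -> (F a * G a)%type} :=
  pair_lin (pmap F f) \0 (pmap G f).

Lemma prod_pmapE a b (f : hom a b) p :
  prod_pmap f p = (pmap F f p.1, pmap G f p.2).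
Proof. by congr pair; rewrite /= add0r. Qed.

Lemma prod_pmap_eq a b (f g : hom a b) : f =h g -> prod_pmap f =1 prod_pmap g.
Proof.
by move=> fg p; rewrite !prod_pmapE; congr pair; exact: pmap_eq.
Qed.

Lemma prod_pmap_id a : prod_pmap (idh a) =1 id.
Proof. by move=> [x y]; rewrite prod_pmapE /= !pmap_id. Qed.

Lemma prod_pmap_comp a b c (g : hom b c) (f : hom a b) :
  prod_pmap (g \oh f) =1 prod_pmap f \o prod_pmap g.
Proof.
move=> p; rewrite -[RHS]/(prod_pmap f (prod_pmap g p)) !prod_pmapE.
by rewrite /= !pmap_comp.
Qed.

Definition prod_psh : presheaf :=
  @Presheaf (fun a => F a * G a)%type prod_pmap prod_pmap_eq prod_pmap_id
    prod_pmap_comp.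

End Cone.

Section ConeComplex.
Variables (X Y : complex) (f : cmap X Y).

Definition degree_cast (Z : complex) i j (e : i = j) : psh_map (Z i) (Z j) :=
  match e in _ = j return psh_map (Z i) (Z j) with erefl => pm_id (Z i) end.

(* f seen as a map X_i -> Y_j, zero unless i = j *)
Definition cm_at i j : psh_map (X i) (Y j) :=
  match i =P j with
  | ReflectT e => pm_comp (degree_cast Y e) (f i)
  | ReflectF _ => pm_zero (X i) (Y j)
  end.

Lemma cm_atE i a x : cm_at i i a x = f i a x.
Proof.
by rewrite /cm_at; case: eqP => // e; rewrite (eq_irrelevance e erefl).
Qed.

Lemma cm_at_neq i j a x : i <> j -> cm_at i j a x = 0.
Proof. by rewrite /cm_at; case: eqP. Qed.

Definition cone_psh n : presheaf := prod_psh (X (n - 1)) (Y n).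

Definition cone_lin i j a : {linear cone_psh i a -> cone_psh j a} :=
  pair_lin (-1 \*: cd X (i - 1) (j - 1) a) (cm_at (i - 1) j a) (cd Y i j a).

Lemma cone_linE i j a p : cone_lin i j a p =
  (- cd X (i - 1) (j - 1) a p.1, cm_at (i - 1) j a p.1 + cd Y i j a p.2).
Proof. by congr pair; rewrite /= scaleN1r. Qed.

Lemma cone_cd_nat i j a b (u : hom a b) p :
  cone_lin i j a (pmap (cone_psh i) u p)
  = pmap (cone_psh j) u (cone_lin i j b p).
Proof.
rewrite !cone_linE -[pmap _ u p]/(prod_pmap _ _ u p).
rewrite -[RHS]/(prod_pmap _ _ u _) !prod_pmapE /=.
by rewrite !pm_nat linearN linearD.
Qed.

Definition cone_cd i j : psh_map (cone_psh i) (cone_psh j) :=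
  @PshMap (cone_psh i) (cone_psh j) (cone_lin i j) (@cone_cd_nat i j).

Lemma cone_cd_shape i j a p : i <> j + 1 -> cone_cd i j a p = 0.
Proof.
move=> ij; rewrite -[LHS]/(cone_lin i j a p) cone_linE.
have ij1 : i - 1 <> j by lia.
have ij2 : i - 1 <> j - 1 + 1 by lia.
by rewrite !cd_shape// cm_at_neq// oppr0 addr0.
Qed.

Lemma cone_cd_cd i j l a p : cone_cd j l a (cone_cd i j a p) = 0.
Proof.
rewrite -[LHS]/(cone_lin j l a (cone_lin i j a p)) !cone_linE /=.
rewrite (linearN (cd X (j - 1) (l - 1) a)) (linearN (cm_at (j - 1) l a)).
rewrite cd_cd !oppr0; congr pair; rewrite linearD cd_cd addr0.
have [jl|/eqP jl] := eqVneq (j - 1) l; last first.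
  have jl1 : j <> l + 1 by lia.
  by rewrite (cm_at_neq _ jl) cd_shape// oppr0 addr0.
subst l; rewrite cm_atE cm_cd.
have [ij|/eqP ij] := eqVneq (i - 1) j; first by subst j; rewrite cm_atE addNr.
have ij1 : i - 1 <> j - 1 + 1 by lia.
by rewrite (cm_at_neq _ ij) linear0 cd_shape// oppr0 addr0.
Qed.

Definition cone : complex := Complex cone_cd_shape cone_cd_cd.

End ConeComplex.

(* Tensor product of complexes over k, computed objectwise: in degree n it is
   generated by the symbols x @ y with x in X_i, y in Y_j and i + j = n, and
   d (x @ y) = d x @ y + (-1)^i x @ d y. *)

Section Tensor.
Variables X Y : complex.

Record tgen (n : int) (a : C) := TGen {
  tg_i : int;
  tg_j : int;
  tg_deg : tg_i + tg_j = n;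
  tg_x : X tg_i a;
  tg_y : Y tg_j a }.

Inductive tensor_rel n a : seq (k * tgen n a) -> Prop :=
| tensor_l i j (e : i + j = n) c (x x' : X i a) (y : Y j a) :
    tensor_rel (lin_relator c (TGen e (c *: x + x') y) (TGen e x y)
      (TGen e x' y))
| tensor_r i j (e : i + j = n) c (x : X i a) (y y' : Y j a) :
    tensor_rel (lin_relator c (TGen e x (c *: y + y')) (TGen e x y)
      (TGen e x y')).

Definition tensor_mod n a : lmodType k := pres (@tensor_rel n a).

Definition tens n a i j (e : i + j = n) (x : X i a) (y : Y j a) :
  tensor_mod n a := pgen (@tensor_rel n a) (TGen e x y).

Lemma tens_linearl n a i j (e : i + j = n) (y : Y j a) :
  linear (fun x : X i a => tens e x y).
Proof.
move=> c x x'; apply/(fsum_lin (pgen (@tensor_rel n a))); apply: pgen_kills.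
exact: tensor_l.
Qed.

Lemma tens_linearr n a i j (e : i + j = n) (x : X i a) :
  linear (fun y : Y j a => tens e x y).
Proof.
move=> c y y'; apply/(fsum_lin (pgen (@tensor_rel n a))); apply: pgen_kills.
exact: tensor_r.
Qed.

Lemma tens0l n a i j (e : i + j = n) (y : Y j a) : tens e (0 : X i a) y = 0.
Proof.
by have := tens_linearl e y (-1) 0 0; rewrite scaler0 addr0 scaleN1r addNr.
Qed.

Lemma tens0r n a i j (e : i + j = n) (x : X i a) : tens e x (0 : Y j a) = 0.
Proof.
by have := tens_linearr e x (-1) 0 0; rewrite scaler0 addr0 scaleN1r addNr.
Qed.

Section TensorLift.
Variables (n : int) (a : C) (W : lmodType k).
Variable b : forall i j, i + j = n -> X i a -> Y j a -> W.
Hypothesis bl : forall i j (e : i + j = n) y, linear (fun x => b e x y).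
Hypothesis br : forall i j (e : i + j = n) x, linear (fun y => b e x y).

Lemma tensor_lift_kills : kills (@tensor_rel n a)
  (fun g : tgen n a => b (tg_deg g) (tg_x g) (tg_y g)).
Proof.
move=> _ [i j e c x x' y|i j e c x y y']; apply/fsum_lin.
  exact: bl.
exact: br.
Qed.

Definition tensor_lift : {linear tensor_mod n a -> W} :=
  plift tensor_lift_kills.

Lemma tensor_liftE i j (e : i + j = n) x y : tensor_lift (tens e x y) = b e x y.
Proof. exact: plift_gen. Qed.

End TensorLift.

Lemma tensor_ext n a (W : lmodType k) (f g : {linear tensor_mod n a -> W}) :
  (forall i j (e : i + j = n) x y, f (tens e x y) = g (tens e x y)) -> f =1 g.
Proof. by move=> fg; apply: pres_ext => -[i j e x y]; exact: fg. Qed.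

Section TensorPmap.
Variables (n : int) (a b : C) (f : hom a b).

Lemma tensor_pmapl i j (e : i + j = n) (y : Y j b) :
  linear (fun x : X i b => tens e (pmap (X i) f x) (pmap (Y j) f y)).
Proof. by move=> c x x'; rewrite linearP; exact: tens_linearl. Qed.

Lemma tensor_pmapr i j (e : i + j = n) (x : X i b) :
  linear (fun y : Y j b => tens e (pmap (X i) f x) (pmap (Y j) f y)).
Proof. by move=> c y y'; rewrite linearP; exact: tens_linearr. Qed.

Definition tensor_pmap : {linear tensor_mod n b -> tensor_mod n a} :=
  tensor_lift tensor_pmapl tensor_pmapr.

Lemma tensor_pmapE i j (e : i + j = n) x y :
  tensor_pmap (tens e x y) = tens e (pmap (X i) f x) (pmap (Y j) f y).
Proof. exact: tensor_liftE. Qed.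

End TensorPmap.

Lemma tensor_pmap_eq n a b (f g : hom a b) :
  f =h g -> tensor_pmap n f =1 tensor_pmap n g.
Proof.
move=> fg; apply: tensor_ext => i j e x y; rewrite !tensor_pmapE.
by congr tens; exact: pmap_eq.
Qed.

Lemma tensor_pmap_id n a : tensor_pmap n (idh a) =1 id.
Proof.
apply: (@tensor_ext _ _ _ _ idfun) => i j e x y.
by rewrite tensor_pmapE !pmap_id.
Qed.

Lemma tensor_pmap_comp n a b c (g : hom b c) (f : hom a b) :
  tensor_pmap n (g \oh f) =1 tensor_pmap n f \o tensor_pmap n g.
Proof.
apply: (@tensor_ext _ _ _ _ (tensor_pmap n f \o tensor_pmap n g)) => i j e x y.
rewrite -[RHS]/(tensor_pmap n f (tensor_pmap n g _)) !tensor_pmapE.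
by rewrite !pmap_comp.
Qed.

Definition tensor_psh n : presheaf :=
  @Presheaf (tensor_mod n) (@tensor_pmap n) (@tensor_pmap_eq n)
    (@tensor_pmap_id n) (@tensor_pmap_comp n).

Lemma deg_l i j n m : i + j = n -> n = m + 1 -> i - 1 + j = m :> int.
Proof. lia. Qed.

Lemma deg_r i j n m : i + j = n -> n = m + 1 -> i + (j - 1) = m :> int.
Proof. lia. Qed.

Definition tensor_d_fun n m a i j (e : i + j = n) (x : X i a) (y : Y j a) :
    tensor_mod m a :=
  match n =P m + 1 with
  | ReflectT nm => tens (deg_l e nm) (cd X i (i - 1) a x) y
                 + (-1) ^ i *: tens (deg_r e nm) x (cd Y j (j - 1) a y)
  | ReflectF _ => 0
  end.

Lemma tensor_dl n m a i j (e : i + j = n) (y : Y j a) :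
  linear (fun x : X i a => tensor_d_fun m e x y).
Proof.
move=> c x x'; rewrite /tensor_d_fun; case: eqP => nm; last first.
  by rewrite scaler0 addr0.
rewrite linearP !tens_linearl !scalerDr addrACA; congr (_ + _ + (_ + _)).
by rewrite !scalerA mulrC.
Qed.

Lemma tensor_dr n m a i j (e : i + j = n) (x : X i a) :
  linear (fun y : Y j a => tensor_d_fun m e x y).
Proof.
move=> c y y'; rewrite /tensor_d_fun; case: eqP => nm; last first.
  by rewrite scaler0 addr0.
rewrite linearP !tens_linearr !scalerDr addrACA; congr (_ + _ + (_ + _)).
by rewrite !scalerA mulrC.
Qed.

Definition tensor_d n m a : {linear tensor_psh n a -> tensor_psh m a} :=
  tensor_lift (@tensor_dl n m a) (@tensor_dr n m a).

Lemma tensor_dE n m a i j (e : i + j = n) (x : X i a) (y : Y j a) :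
  tensor_d n m a (tens e x y) = tensor_d_fun m e x y.
Proof. exact: tensor_liftE. Qed.

Lemma tensor_d_nat n m a b (f : hom a b) t :
  tensor_d n m a (pmap (tensor_psh n) f t)
  = pmap (tensor_psh m) f (tensor_d n m b t).
Proof.
move: t; apply: (@tensor_ext _ _ _ (tensor_d n m a \o tensor_pmap n f)
  (tensor_pmap m f \o tensor_d n m b)) => i j e x y.
rewrite -[LHS]/(tensor_d n m a (tensor_pmap n f _)).
rewrite -[RHS]/(tensor_pmap m f (tensor_d n m b _)).
rewrite tensor_pmapE !tensor_dE /tensor_d_fun; case: eqP => nm; last first.
  by rewrite linear0.
by rewrite linearD linearZ !tensor_pmapE !pm_nat.
Qed.

Definition tensor_cd n m : psh_map (tensor_psh n) (tensor_psh m) :=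
  @PshMap (tensor_psh n) (tensor_psh m) (tensor_d n m) (@tensor_d_nat n m).

Lemma tensor_cd_shape n m a t : n <> m + 1 -> tensor_cd n m a t = 0.
Proof.
move=> nm; move: t; apply: (@tensor_ext _ _ _ (tensor_d n m a) \0).
by move=> i j e x y; rewrite tensor_dE /tensor_d_fun; case: eqP.
Qed.

Lemma tensor_cd_cd n m l a t : tensor_cd m l a (tensor_cd n m a t) = 0.
Proof.
move: t; apply: (@tensor_ext _ _ _ (tensor_d m l a \o tensor_d n m a) \0).
move=> i j e x y; rewrite -[LHS]/(tensor_d m l a (tensor_d n m a _)).
rewrite tensor_dE /tensor_d_fun; case: eqP => nm; last by rewrite linear0.
rewrite linearD linearZ !tensor_dE /tensor_d_fun [X in _ + X]/=.
case: eqP => ml; last by rewrite scaler0 addr0.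
rewrite !cd_cd tens0l tens0r add0r scaler0 addr0.
rewrite (Prop_irrelevance (deg_l (deg_r e nm) ml) (deg_r (deg_l e nm) ml)).
rewrite -scalerDl expfzDr ?oppr_eq0 ?oner_eq0//.
by rewrite (_ : (-1 : k) ^ (-1) = -1) ?mulrN1 ?addNr ?scale0r// exprN1 invrN1.
Qed.

Definition tensor : complex := Complex tensor_cd_shape tensor_cd_cd.

End Tensor.

Lemma const_cd_shape (V : int -> lmodType k) i j a
  (x : const_psh (V i) a) :
  i <> j + 1 -> pm_zero (const_psh (V i)) (const_psh (V j)) a x = 0.
Proof. by []. Qed.

Lemma const_cd_cd (V : int -> lmodType k) i j l a (x : const_psh (V i) a) :
  pm_zero (const_psh (V j)) (const_psh (V l)) a
    (pm_zero (const_psh (V i)) (const_psh (V j)) a x) = 0.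
Proof. by []. Qed.

Definition const_complex (V : int -> lmodType k) : complex :=
  @Complex (fun n => const_psh (V n))
    (fun i j => pm_zero (const_psh (V i)) (const_psh (V j)))
    (@const_cd_shape V) (@const_cd_cd V).

(* 'rV[k]_(n == 0) is k for n = 0 and 0 otherwise. *)
Definition unit_complex : complex := const_complex (fun n => 'rV[k]_(n == 0)).
Definition zero_complex : complex := const_complex (fun=> 'rV[k]_0).

(* The derived category: the localization of the preadditive category of
   complexes at the quasi-isomorphisms, presented by formal composites and sums
   of chain maps and of inverses of quasi-isomorphisms. *)

Inductive dhom : complex -> complex -> Type :=
| dmap X Y (f : cmap X Y) : dhom X Y
| dinv X Y (s : cmap X Y) (qs : quasi_iso s) : dhom Y X
| dcomp X Y Z (g : dhom Y Z) (f : dhom X Y) : dhom X Z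
| dadd X Y (f g : dhom X Y) : dhom X Y.

Definition dzero X Y : dhom X Y := dmap (cm_zero X Y).

Inductive deq : forall X Y, dhom X Y -> dhom X Y -> Prop :=
| deq_refl X Y (f : dhom X Y) : deq f f
| deq_sym X Y (f g : dhom X Y) : deq f g -> deq g f
| deq_trans X Y (f g h : dhom X Y) : deq f g -> deq g h -> deq f h
| deq_comp X Y Z (g g' : dhom Y Z) (f f' : dhom X Y) :
    deq g g' -> deq f f' -> deq (dcomp g f) (dcomp g' f')
| deq_add X Y (f f' g g' : dhom X Y) :
    deq f f' -> deq g g' -> deq (dadd f g) (dadd f' g')
| deq_idl X Y (f : dhom X Y) : deq (dcomp (dmap (cm_id Y)) f) f
| deq_idr X Y (f : dhom X Y) : deq (dcomp f (dmap (cm_id X))) f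
| deq_compA X Y Z T (h : dhom Z T) (g : dhom Y Z) (f : dhom X Y) :
    deq (dcomp h (dcomp g f)) (dcomp (dcomp h g) f)
| deq_addA X Y (f g h : dhom X Y) : deq (dadd f (dadd g h)) (dadd (dadd f g) h)
| deq_addC X Y (f g : dhom X Y) : deq (dadd f g) (dadd g f)
| deq_add0 X Y (f : dhom X Y) : deq (dadd (dzero X Y) f) f
| deq_compDl X Y Z (g g' : dhom Y Z) (f : dhom X Y) :
    deq (dcomp (dadd g g') f) (dadd (dcomp g f) (dcomp g' f))
| deq_compDr X Y Z (g : dhom Y Z) (f f' : dhom X Y) :
    deq (dcomp g (dadd f f')) (dadd (dcomp g f) (dcomp g f'))
| deq_comp0l X Y Z (f : dhom X Y) : deq (dcomp (dzero Y Z) f) (dzero X Z)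
| deq_comp0r X Y Z (g : dhom Y Z) : deq (dcomp g (dzero X Y)) (dzero X Z)
| deq_map X Y (f g : cmap X Y) :
    (forall n a x, f n a x = g n a x) -> deq (dmap f) (dmap g)
| deq_map_comp X Y Z (g : cmap Y Z) (f : cmap X Y) :
    deq (dmap (cm_comp g f)) (dcomp (dmap g) (dmap f))
| deq_map_add X Y (f g : cmap X Y) :
    deq (dmap (cm_add f g)) (dadd (dmap f) (dmap g))
| deq_invl X Y (s : cmap X Y) (qs : quasi_iso s) :
    deq (dcomp (dinv qs) (dmap s)) (dmap (cm_id X))
| deq_invr X Y (s : cmap X Y) (qs : quasi_iso s) :
    deq (dcomp (dmap s) (dinv qs)) (dmap (cm_id Y)).

Definition derived : category :=
  @Category complex dhom deq (fun X => dmap (cm_id X)) dcomp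
    deq_refl deq_sym deq_trans deq_comp deq_idl deq_idr deq_compA.

(* X is compact: the canonical map from the direct sum of the Hom (X, Y_i) to
   Hom (X, sum_i Y_i) is bijective for every family (Y_i)_i.  The image of a
   family (f_i) supported on the finite set s is [dsum s f]. *)

Definition dsum (X : complex) (I : Type) (Y : I -> complex)
    (s : seq {classic I}) (f : forall i, dhom X (Y i)) :
    dhom X (sum_complex Y) :=
  foldr (fun i g => dadd (dcomp (dmap (sum_incl Y i)) (f i)) g) (dzero _ _) s.

Definition compact_object (X : derived) : Prop :=
  forall (I : Type) (Y : I -> complex),
    (forall h : dhom X (sum_complex Y),
       exists (s : seq {classic I}) (f : forall i, dhom X (Y i)),
         uniq s /\ deq h (dsum s f)) /\
    (forall (s : seq {classic I}) (f : forall i, dhom X (Y i)),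
       uniq s -> deq (dsum s f) (dzero _ _) ->
       forall i : {classic I}, i \in s -> deq (f i) (dzero _ _)).

Definition derived_compact : category := fullsub compact_object.
Definition dc_obj (X : derived_compact) : derived := sval X.

(* X, Y, Z are the vertices of a distinguished triangle X -> Y -> Z -> X[1]. *)
Definition dist_triangle (X Y Z : derived) : Prop :=
  exists (X' Y' : complex) (f : cmap X' Y'),
    [/\ @iso derived X X', @iso derived Y Y' & @iso derived Z (cone f)].

Definition is_tensor (X Y Z : derived) : Prop := iso Z (tensor X Y : derived).

(* D^c is regarded as a full subcategory of D: its distinguished triangles and
   tensor products are those of D whose objects are all compact. *)
Record prime_thick_ideal (P : derived_compact -> Prop) : Prop := {
  pti_replete : replete P;
  pti_zero : forall Z, iso (dc_obj Z) (zero_complex : derived) -> P Z;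
  pti_triangle : forall X Y Z,
    dist_triangle (dc_obj X) (dc_obj Y) (dc_obj Z) ->
    [/\ P X -> P Y -> P Z, P Y -> P Z -> P X & P X -> P Z -> P Y];
  pti_retract : forall (X Y : derived_compact) (i : hom X Y) (r : hom Y X),
    r \oh i =h idh X -> P Y -> P X;
  pti_ideal : forall X Y Z,
    is_tensor (dc_obj X) (dc_obj Y) (dc_obj Z) -> P X -> P Z;
  pti_proper : exists X, ~ P X;
  pti_prime : forall X Y Z,
    is_tensor (dc_obj X) (dc_obj Y) (dc_obj Z) -> P Z -> P X \/ P Y }.

Definition Spc : Type := {P : derived_compact -> Prop | prime_thick_ideal P}.

End Presheaves.

Section GroupPrime.
Variables (k : fieldType) (U : finGrp -> Prop) (G : topologicalGroupType).

(* The maps H_n(X)(G/N) -> H_n(X)(G/N') for N' contained in N, induced by the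
   projection G/N' -> G/N. *)
Definition quo_transition (F : presheaf k (fullsub U)) (N N' : {N | NN U N})
    (t : {linear F (fq_ob (quo N)) -> F (fq_ob (quo N'))}) : Prop :=
  exists rho : hom (fq_ob (@quo U G N')) (fq_ob (quo N)),
    (forall x, rho (fq_proj (quo N') x) = fq_proj (quo N) x) /\ t = pmap F rho.

Definition colim_quotients (F : presheaf k (fullsub U)) : lmodType k :=
  colim (@quo_transition F).

Definition group_prime (X : derived_compact k (fullsub U)) : Prop :=
  forall (n : int) (c : colim_quotients (homology (dc_obj X) n)), c = 0.

End GroupPrime.

(* Main.v *)
(* Over a field the homology of a complex of presheaves is a tensor functor at
   each object (Kuenneth), and a filtered colimit is exact, so each p_G is a
   prime thick ideal; the unit lies outside it because a filtered colimit of
   copies of k is k.  For injectivity, let k[hom (-, Q)] be the representable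
   presheaf of Q in U.  By the Yoneda lemma in the derived category it is
   compact, and it lies in p_G exactly when G has no continuous surjection onto
   Q.  Hence p_G determines which groups of U are continuous quotients of G.  A
   topologically finitely generated profinite group has only finitely many
   continuous maps to a finite group; so, if G and H have the same quotients in
   U, compactness gives continuous surjections G -> H and H -> G, and every
   continuous surjective endomorphism of G is injective, so that both are
   isomorphisms. *)

From mathcomp Require Import all_boot all_algebra all_fingroup.
From mathcomp Require Import zify.
From mathcomp Require Import all_classical.
From mathcomp Require Import topology.
Require Import Defs.

Set Implicit Arguments.
Unset Strict Implicit.
Unset Printing Implicit Defensive.

Import GRing.Theory.
Local Open Scope classical_set_scope.
Local Open Scope ring_scope.

(** * Linear algebra over a field *)

(** A morphism of [derived] is only a formal composite of chain maps and inverses of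
    quasi-isomorphisms, with no normal form to compute with. Facts about such morphisms are
    therefore proved by induction on [dhom]: they act on homology ([hmap]), and composing one with a
    chain map out of a representable complex gives such a chain map again, up to [deq]
    ([dcomp_rep_map]). Homology, tensor products and colimits are presented modules, where equality
    is tested by all maps killing the relators; showing that a zero class is a boundary, or that an
    element is nonzero, calls for a linear map with a prescribed kernel. These maps come from a
    single use of Zorn's lemma, [linear_selection]. The Kuenneth argument is run on cycles:
    membership in p_G is rephrased as every cycle becoming a boundary over a smaller open normal
    subgroup ([hvanishes]), and complexes are split at one object at a time, since such splittings
    are not compatible with restriction. *)

Section LinearSelection.
Variables (k : fieldType) (V W : lmodType k) (R : W -> V -> Prop).
Hypothesis R0 : R 0 0.
Hypothesis R_lin :
  forall c w v w' v', R w v -> R w' v' -> R (c *: w + w') (c *: v + v').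

Let dom w := exists v, R w v.
Let ran v := exists w, R w v.

(* On the domain of [R], the values of the selection are forced to be related
   by [R]; elsewhere they only need to stay in the range. *)
Let partial_selection (D : set (W * V)) : Prop :=
  [/\ forall c p q, D p -> D q -> D (c *: p + q),
      forall w v v', D (w, v) -> D (w, v') -> v = v' &
      forall w v, D (w, v) -> (dom w -> R w v) /\ ran v].

Lemma partial_selection_bigcup (F : set (set (W * V))) :
  F `<=` partial_selection -> total_on F subset ->
  partial_selection (\bigcup_(D in F) D).
Proof.
move=> FP Ftot.
have common p q : (\bigcup_(D in F) D) p -> (\bigcup_(D in F) D) q ->
    exists D, [/\ F D, D p & D q].
  move=> [D FD Dp] [E FE Eq]; have [DE|ED] := Ftot _ _ FD FE.
    by exists E; split=> //; exact: DE.
  by exists D; split=> //; exact: ED.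
split=> [c p q Up Uq|w v v' Up Uq|w v [D FD Dwv]].
- have [D [FD Dp Dq]] := common _ _ Up Uq.
  by exists D => //; have [+ _ _] := FP _ FD; apply.
- have [D [FD Dp Dq]] := common _ _ Up Uq.
  by have [_ + _] := FP _ FD; apply; [exact: Dp|exact: Dq].
- by have [_ _ +] := FP _ FD; exact.
Qed.

Lemma partial_selection0 : partial_selection [set 0].
Proof.
split=> [c p q -> ->|w v v' [_ ->] [_ ->]|w v [-> ->]] //=.
  by rewrite scaler0 addr0.
by split=> //; exists 0.
Qed.

(** If [w0 + w1] is related to some [u] for a pair [(w1, v1)] of [D], take [v0 = u - v1]. Any other
    such [w] differs from [w1] by an element of the domain of [R], where [D] already agrees with
    [R], so one choice serves all of them. If no such pair exists, [v0 = 0] will do. *)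
Lemma partial_selection_extend (D : set (W * V)) w0 :
    partial_selection D -> D 0 -> ~ (exists v, D (w0, v)) ->
  exists2 E, partial_selection E & D `<` E.
Proof.
move=> [Dlin Dfun DR] D0 w0D.
have [v0 [ranv0 v0P]] : exists v0, ran v0 /\
    forall w v, D (w, v) -> dom (w0 + w) -> R (w0 + w) (v0 + v).
  have [[w1 [v1 [Dw1 [u Ru]]]]|nD] := pselect (exists w1 v1,
      D (w1, v1) /\ dom (w0 + w1)); last first.
    exists 0; split; first by exists 0.
    by move=> w v Dwv dw; case: nD; exists w, v.
  exists (u - v1); split.
    have [_ [w1' Rw1']] := DR _ _ Dw1.
    exists (-1 *: w1' + (w0 + w1)).
    by rewrite [u - v1]addrC -[- v1]scaleN1r; exact: R_lin.
  move=> w v Dwv [u' Ru'].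
  have Ddiff : D (w - w1, v - v1).
    have := Dlin (-1) _ _ Dw1 Dwv.
    by rewrite -[_ *: _ + _]/(_, _)/= !scaleN1r ![- _ + _]addrC.
  have domdiff : dom (w - w1).
    exists (-1 *: u + u').
    have := R_lin (-1) Ru Ru'.
    suff -> : -1 *: (w0 + w1) + (w0 + w) = w - w1 by [].
    by rewrite scaleN1r opprD addrACA addNr add0r addrC.
  have [/(_ domdiff) Rdiff _] := DR _ _ Ddiff.
  have := R_lin 1 Rdiff Ru.
  rewrite !scale1r.
  have -> : w - w1 + (w0 + w1) = w0 + w by rewrite [w0 + _]addrC addrA subrK
    addrC.
  by have -> : v - v1 + u = u - v1 + v by rewrite addrC addrA addrAC.
pose E : set (W * V) := [set p | exists c q, D q /\ p = q + c *: (w0, v0)].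
exists E; last first.
  split; first by move=> q Dq; exists 0, q; rewrite scale0r addr0.
  move=> /(_ (w0, v0)) ED; apply: w0D; exists v0; apply: ED.
  by exists 1, 0; rewrite scale1r add0r.
have DZ c q : D q -> D (c *: q).
  by move=> Dq; have := Dlin c _ _ Dq D0; rewrite addr0.
split.
- move=> c _ _ [a [p [Dp ->]]] [b [q [Dq ->]]].
  exists (c * a + b), (c *: p + q); split; first exact: Dlin.
  by rewrite scalerDr scalerDl scalerA addrACA.
- move=> w v v' [a [[p1 p2] [Dp pE]]] [b [[q1 q2] [Dq qE]]].
  case: pE qE => -> -> [wE ->].
  (* Two decompositions with different coefficients would put [w0] in the domain of [D]. *)
  have [ab|ab] := eqVneq a b.
    subst b; congr (_ + _); apply: Dfun Dp _.
    suff -> : p1 = q1 by [].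
    exact: addIr wE.
  case: w0D; exists ((b - a)^-1 *: (p2 - q2)).
  have -> : w0 = (b - a)^-1 *: (p1 - q1).
    apply: (@scalerI _ _ (b - a)); first by rewrite subr_eq0 eq_sym.
    rewrite scalerA divff ?scale1r; last by rewrite subr_eq0 eq_sym.
    by rewrite scalerBl; apply/eqP; rewrite subr_eq addrAC eq_sym subr_eq wE
      addrC.
  apply: (DZ _ (_, _)).
  have := Dlin (-1) _ _ Dq Dp.
  by rewrite -[_ *: _ + _]/(_, _)/= !scaleN1r ![- _ + _]addrC.
- move=> w v [c [[p1 p2] [Dp [-> ->]]]].
  have [dR [r rP]] := DR _ _ Dp; split; last first.
    have [w' Rw'] := ranv0.
    by exists (c *: w' + r); rewrite [p2 + _]addrC; exact: R_lin.
  have [->|c0] := eqVneq c 0; first by rewrite !scale0r !addr0.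
  move=> [u Ru].
  have e (X : lmodType k) (x y : X) : x + c *: y = c *: (y + c^-1 *: x) + 0.
    by rewrite addr0 scalerDr scalerA divff// scale1r addrC.
  rewrite !e; apply: R_lin R0; apply: v0P; first exact: (DZ _ (_, _)).
  exists (c^-1 *: u + 0).
  have -> : w0 + c^-1 *: p1 = c^-1 *: (p1 + c *: w0) + 0.
    by rewrite addr0 scalerDr scalerA mulVf// scale1r addrC.
  exact: R_lin.
Qed.

Lemma linear_selection : exists s : {linear W -> V},
  (forall w, (exists v, R w v) -> R w (s w)) /\
  (forall w, exists w', R w' (s w)).
Proof.
have [D [DP Dmax]] := Zorn_bigcup partial_selection_bigcup.
(* The empty set is also a partial selection; maximality against [[set 0]] excludes it. *)
have D0 : D 0.
  have [[p Dp]|De] := pselect (D !=set0).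
    have [Dlin _ _] := DP; have := Dlin (-1) _ _ Dp Dp.
    by rewrite scaleN1r addNr.
  exfalso; apply: (Dmax [set 0] _ partial_selection0).
  by split=> [p Dp|/(_ 0 erefl) D0]; case: De; [exists p|exists 0].
have Dtot w : exists v, D (w, v).
  apply: contrapT => wD.
  by have [E EP DE] := partial_selection_extend DP D0 wD; exact: Dmax DE EP.
have [s sD] := choice Dtot.
have [Dlin Dfun DR] := DP.
have s_lin : linear s.
  move=> c w w'; apply: (Dfun _ _ _ (sD _)).
  exact: (Dlin c _ _ (sD w) (sD w')).
exists (mklin s_lin); split=> w.
  by move=> ?; have [+ _] := DR _ _ (sD w); exact.
by have [] := DR _ _ (sD w).
Qed.

End LinearSelection.

Lemma linear_generalized_inverse (k : fieldType) (V W : lmodType k)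
    (d : {linear V -> W}) :
  exists s : {linear W -> V}, forall v, d (s (d v)) = d v.
Proof.
have [||s [sP _]] := @linear_selection k V W (fun w v => d v = w).
- by rewrite linear0.
- by move=> c w v w' v' <- <-; rewrite linearP.
by exists s => v; apply: sP; exists v.
Qed.

(** The selection for the identity relation on [B] is a projection onto [B], and [p] is its
    complement. Such a [p] plays the role of the quotient map by [B] whenever a test map out of a
    presented module is needed. *)
Lemma subspace_is_kernel (k : fieldType) (V : lmodType k) (B : V -> Prop) :
  B 0 -> (forall c u v, B u -> B v -> B (c *: u + v)) ->
  exists p : {linear V -> V}, forall v, p v = 0 <-> B v.
Proof.
move=> B0 Blin.
have [||s [sid sB]] := @linear_selection k V V (fun w v => B v /\ w = v).
- by [].
- by move=> c w v w' v' [Bv ->] [Bv' ->]; split=> //; exact: Blin.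
exists (idfun \- s)%R => v; split=> [/eqP|Bv].
  by rewrite /= subr_eq0 => /eqP vE; have [? []] := sB v; rewrite -vE.
rewrite /=; have [] := sid v; first by exists v.
by move=> _ <-; rewrite subrr.
Qed.

Lemma functional_separates (k : fieldType) (V : lmodType k) (B : V -> Prop) v :
    B 0 -> (forall c u v, B u -> B v -> B (c *: u + v)) -> ~ B v ->
  exists phi : {linear V -> k^o}, phi v = 1 /\ forall u, B u -> phi u = 0.
Proof.
move=> B0 Blin Bv; have [p pB] := subspace_is_kernel B0 Blin.
have pv : p v != 0 by apply/eqP => /pB.
have lin : linear (fun c : k^o => c *: p v).
  by move=> a c c'; rewrite scalerDl scalerA.
have [t tP] := linear_generalized_inverse (mklin lin).
exists (t \o p)%R; split=> [|u /pB /= ->]; last by rewrite linear0.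
have /eqP : (t (p v) - 1 : k) *: p v = 0.
  by have := tP 1; rewrite /= !scale1r scalerBl => ->; rewrite scale1r subrr.
by rewrite scaler_eq0 (negbTE pv) orbF subr_eq0 => /eqP.
Qed.

(** * Homology classes *)

Section HomologyClasses.
Variables (k : fieldType) (C : category).
Implicit Types (X Y : complex k C) (n : int) (a : C).

Definition hclass X n a (z : cycle X n a) : homology X n a :=
  pgen (@homology_rel k C X n a) z.

Definition boundary X n a (x : X n a) : Prop :=
  exists y : X (n + 1) a, x = cd X (n + 1) n a y.

Lemma cd_boundary X i n a (y : X i a) : boundary (cd X i n a y).
Proof.
have [in1|/eqP in1] := eqVneq i (n + 1); first by subst i; exists y.
by exists 0; rewrite linear0 cd_shape.
Qed.

Lemma boundary0 X n a : boundary (0 : X n a).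
Proof. by exists 0; rewrite linear0. Qed.

Lemma boundary_lin X n a c (x x' : X n a) :
  boundary x -> boundary x' -> boundary (c *: x + x').
Proof. by move=> [y ->] [y' ->]; exists (c *: y + y'); rewrite linearP. Qed.

Lemma boundary_pmap X n a b (f : hom a b) (x : X n b) :
  boundary x -> boundary (pmap (X n) f x).
Proof. by move=> [y ->]; exists (pmap (X _) f y); rewrite pm_nat. Qed.

Lemma cycle_lin_closed X n a c (z z' : cycle X n a) j :
  cd X n j a (c *: sval z + sval z') = 0.
Proof. by rewrite linearP (proj2_sig z) (proj2_sig z') scaler0 addr0. Qed.

Definition cycle_lin X n a c (z z' : cycle X n a) : cycle X n a :=
  exist _ (c *: sval z + sval z') (cycle_lin_closed c z z').

Definition cycle0 X n a : cycle X n a :=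
  exist (fun x : X n a => forall j, cd X n j a x = 0) 0
    (fun j => linear0 (cd X n j a)).

Lemma hclass_lin X n a c (z x y : cycle X n a) :
  sval z = c *: sval x + sval y -> hclass z = c *: hclass x + hclass y.
Proof.
move=> zE; apply/(fsum_lin (pgen (@homology_rel k C X n a))); apply: pgen_kills.
exact: homology_lin.
Qed.

(** From left to right, a linear map whose kernel is exactly the boundaries kills the relators of
    homology, so it may be evaluated on the vanishing class. *)
Lemma hclass_eq0 X n a (z : cycle X n a) : hclass z = 0 <-> boundary (sval z).
Proof.
split=> [z0|[y zE]]; last first.
  apply/fsum_zero; apply: pgen_kills; exact: homology_bound zE.
have [p pB] := subspace_is_kernel (boundary0 X n a) (@boundary_lin X n a).
have pk : kills (@homology_rel k C X n a) (fun z => p (sval z)).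
  move=> _ [c x y x' xE|i y x xE]; first by apply/fsum_lin; rewrite xE linearP.
  apply: (proj1 (fsum_zero _ _)); apply/pB; rewrite xE; exact: cd_boundary.
by apply/pB; rewrite -(plift_gen pk) -[pgen _ _]/(hclass z) z0 linear0.
Qed.

Lemma hclass_eq X n a (z z' : cycle X n a) :
  hclass z = hclass z' <-> boundary (sval z - sval z').
Proof.
have e : hclass (cycle_lin (-1) z' z) = hclass z - hclass z'.
  by rewrite (hclass_lin (c := -1) (x := z') (y := z)) // scaleN1r addrC.
have -> : sval z - sval z' = sval (cycle_lin (-1) z' z).
  by rewrite /= scaleN1r addrC.
by rewrite -hclass_eq0 e; split=> [->|/eqP]; rewrite ?subrr// subr_eq0 => /eqP.
Qed.

Lemma hclass_surj X n a (u : homology X n a) : exists z, u = hclass z.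
Proof.
suff H (s : seq (k * cycle X n a)) :
    exists z, fsum (pgen (@homology_rel k C X n a)) s = hclass z.
  have [z zE] := H (pres_repr u); exists z; rewrite -zE -pres_ofE.
  apply: pres_eqP => W f fR; rewrite pres_evE //.
elim: s => [|[c z] s [z' IH]].
  exists (cycle0 X n a); rewrite /fsum big_nil; apply/esym/hclass_eq0.
  exact: boundary0.
exists (cycle_lin c z z'); rewrite /fsum big_cons -[X in _ + X]/(fsum _ s) IH.
exact/esym/hclass_lin.
Qed.

Lemma homology_mapE X Y (f : cmap X Y) n a (z : cycle X n a) :
  homology_map f n a (hclass z) = hclass (cycle_map f z).
Proof. exact: plift_gen. Qed.

Lemma homology_pmapE X n a b (f : hom a b) (z : cycle X n b) :
  pmap (homology X n) f (hclass z) = hclass (cycle_pmap f z).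
Proof. exact: plift_gen. Qed.

Lemma homology_map_nat X Y (f : cmap X Y) n a b (u : hom a b) x :
  homology_map f n a (pmap (homology X n) u x)
  = pmap (homology Y n) u (homology_map f n b x).
Proof.
have [z ->] := hclass_surj x; rewrite homology_pmapE !homology_mapE.
rewrite homology_pmapE; congr hclass; apply: cycle_inj => /=.
exact: pm_nat.
Qed.

Lemma quasi_iso_inverse X Y (s : cmap X Y) (qs : quasi_iso s) n a :
  exists t : {linear homology Y n a -> homology X n a},
    cancel (homology_map s n a) t /\ cancel t (homology_map s n a).
Proof.
have [t st ts] := qs n a.
exists (mklin (can2_linear st ts)).
by split.
Qed.

Definition homology_inv X Y (s : cmap X Y) (qs : quasi_iso s) n a :
  {linear homology Y n a -> homology X n a} :=
  projT1 (cid (quasi_iso_inverse qs n a)).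

Lemma homology_invK X Y (s : cmap X Y) (qs : quasi_iso s) n a :
  cancel (homology_inv qs n a) (homology_map s n a).
Proof. exact: (projT2 (cid (quasi_iso_inverse qs n a))).2. Qed.

Lemma homology_mapK X Y (s : cmap X Y) (qs : quasi_iso s) n a :
  cancel (homology_map s n a) (homology_inv qs n a).
Proof. exact: (projT2 (cid (quasi_iso_inverse qs n a))).1. Qed.

(** Homology as a functor on the derived category; a formal inverse acts by the inverse of the
    isomorphism that the quasi-isomorphism induces. *)
Fixpoint hmap X Y (f : dhom X Y) n a : {linear homology X n a ->
  homology Y n a} :=
  match f with
  | dmap X Y f => homology_map f n a
  | dinv X Y s qs => homology_inv qs n a
  | dcomp X Y Z g f => hmap g n a \o hmap f n a
  | dadd X Y f g => hmap f n a \+ hmap g n a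
  end%R.

Lemma hmap_dzero X Y n a x : hmap (dzero X Y) n a x = 0.
Proof.
have [z ->] := hclass_surj x; rewrite homology_mapE.
by apply/hclass_eq0; exact: boundary0.
Qed.

Lemma hmap_deq X Y (f g : dhom X Y) : deq f g ->
  forall n a, hmap f n a =1 hmap g n a.
Proof.
elim=> {X Y f g}; do ?[by move=> *].
- by move=> X Y f g _ fg n a x; rewrite fg.
- by move=> X Y f g h _ fg _ gh n a x; rewrite fg gh.
- by move=> X Y Z g g' f f' _ gg' _ ff' n a x; rewrite /= ff' gg'.
- by move=> X Y f f' g g' _ ff' _ gg' n a x; rewrite /= ff' gg'.
- move=> X Y f n a x; rewrite -[LHS]/(homology_map (cm_id Y) n a (hmap f n a
  x)).
  have [z ->] := hclass_surj (hmap f n a x).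
  by rewrite homology_mapE; congr hclass; apply: cycle_inj.
- move=> X Y f n a x; rewrite -[LHS]/(hmap f n a (homology_map (cm_id X) n a
  x)).
  have [z ->] := hclass_surj x; rewrite homology_mapE.
  by congr (hmap f n a (hclass _)); apply: cycle_inj.
- by move=> X Y f g h n a x /=; rewrite addrA.
- by move=> X Y f g n a x /=; rewrite addrC.
- move=> X Y f n a x; rewrite -[LHS]/(hmap (dzero X Y) n a x + _).
  by rewrite hmap_dzero add0r.
- by move=> X Y Z g f f' n a x /=; rewrite linearD.
- by move=> X Y Z f n a x; rewrite -[LHS]/(hmap (dzero Y Z) n a _) !hmap_dzero.
- move=> X Y Z g n a x; rewrite -[LHS]/(hmap g n a (hmap (dzero X Y) n a x)).
  by rewrite !hmap_dzero linear0.
- move=> X Y f g fg n a x; have [z ->] := hclass_surj x.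
  rewrite !homology_mapE; congr hclass; apply: cycle_inj; exact: fg.
- move=> X Y Z g f n a x; have [z ->] := hclass_surj x.
  rewrite -[LHS]/(homology_map (cm_comp g f) n a _).
  rewrite -[RHS]/(homology_map g n a (homology_map f n a _)).
  by rewrite !homology_mapE; congr hclass; apply: cycle_inj.
- move=> X Y f g n a x; have [z ->] := hclass_surj x.
  rewrite -[LHS]/(homology_map (cm_add f g) n a _).
  rewrite -[RHS]/(homology_map f n a _ + homology_map g n a _) !homology_mapE.
  rewrite -[hclass (cycle_map f z)]scale1r; apply: hclass_lin.
  by rewrite scale1r.
- move=> X Y s qs n a x.
  rewrite -[LHS]/(homology_inv qs n a (homology_map s n a x)) homology_mapK.
  have [z ->] := hclass_surj x; rewrite -[RHS]/(homology_map _ n a _).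
  by rewrite homology_mapE; congr hclass; apply: cycle_inj.
- move=> X Y s qs n a x.
  rewrite -[LHS]/(homology_map s n a (homology_inv qs n a x)) homology_invK.
  have [z ->] := hclass_surj x; rewrite -[RHS]/(homology_map _ n a _).
  by rewrite homology_mapE; congr hclass; apply: cycle_inj.
Qed.

Lemma hmap_nat X Y (f : dhom X Y) n a b (u : hom a b) x :
  hmap f n a (pmap (homology X n) u x) = pmap (homology Y n) u (hmap f n b x).
Proof.
elim: f n a b u x => {X Y} [X Y f|X Y s qs|X Y Z g IHg f IHf|X Y f IHf g IHg]
  n a b u x.
- exact: homology_map_nat.
- apply: (can_inj (homology_mapK qs (n:=n) (a:=a))).
  by rewrite homology_invK homology_map_nat homology_invK.
- by rewrite /= IHf IHg.
- rewrite -[LHS]/(hmap f n a _ + hmap g n a _) IHf IHg.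
  by rewrite -[RHS]/(pmap (homology Y n) u (_ + _)) linearD.
Qed.

End HomologyClasses.

(** * Colimits over open normal subgroups *)

Section DirectSumProjection.
Variables (k : fieldType) (I : Type) (V : I -> lmodType k).

Definition tag_at i (p : {j & V j}) : V i :=
  match pselect (projT1 p = i) with
  | left e => ecast j (V j) e (projT2 p)
  | right _ => 0
  end.

Lemma tag_atE i (x : V i) : tag_at i (existT _ i x) = x.
Proof.
by rewrite /tag_at; case: pselect => //= e; rewrite (Prop_irrelevance e erefl).
Qed.

Lemma tag_at_neq i j (x : V j) : j <> i -> tag_at i (existT _ j x) = 0.
Proof. by rewrite /tag_at; case: pselect. Qed.

Lemma tag_at_linear i j : linear (fun x : V j => tag_at i (existT _ j x)).
Proof.
move=> c x y; have [ji|ji] := pselect (j = i); first by subst j;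
  rewrite !tag_atE.
by rewrite !tag_at_neq// scaler0 addr0.
Qed.

Lemma tag_at_kills i :
  kills (@colim_rel k I V (@no_transition k I V)) (@tag_at i).
Proof.
by move=> _ [j c x y|j l t x []]; apply/fsum_lin; exact: tag_at_linear.
Qed.

Definition dirsum_proj i : {linear dirsum V -> V i} := plift (@tag_at_kills i).

Definition dirsum_in i (x : V i) : dirsum V :=
  @colim_in k I V (@no_transition k I V) i x.

Lemma dirsum_projK i : cancel (@dirsum_in i) (dirsum_proj i).
Proof. by move=> x; rewrite [LHS]plift_gen tag_atE. Qed.

Lemma dirsum_proj_neq i j (x : V j) :
  j <> i -> dirsum_proj i (dirsum_in x) = 0.
Proof. by move=> ji; rewrite [LHS]plift_gen tag_at_neq. Qed.

Lemma dirsum_in_linear i : linear (@dirsum_in i).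
Proof. exact: colim_in_linear. Qed.

Lemma dirsum_in0 i : dirsum_in (0 : V i) = 0.
Proof.
by have := dirsum_in_linear (-1) (0 : V i) 0;
  rewrite scaler0 addr0 scaleN1r addNr.
Qed.

End DirectSumProjection.

Lemma epi_factor (G H K : groupType) (p : epi G H) (q : epi G K) :
    (forall x, p x = 1%g -> q x = 1%g) ->
  exists r : epi H K, forall x, r (p x) = q x.
Proof.
move=> pq.
have [s sP] := choice (@epi_surj _ _ p).
have sE x : q (s (p x)) = q x.
  apply: (mulIg (q x)^-1%g); rewrite mulgV.
  have -> : (q x)^-1%g = q x^-1%g.
    by apply: (mulIg (q x)); rewrite mulVg -epiM mulVg epi1.
  rewrite -epiM; apply: pq.
  by rewrite epiM sP -epiM mulgV epi1.
have rM x y : q (s (x * y)%g) = (q (s x) * q (s y))%g.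
  by rewrite -epiM -(sE (s x * s y)%g) epiM !sP.
have rS y : exists x, q (s x) = y.
  by have [x <-] := epi_surj q y; exists (p x).
by exists (@Epi H K (q \o s) rM rS).
Qed.

Lemma epiV (G H : groupType) (f : epi G H) x : f x^-1%g = (f x)^-1%g.
Proof. by apply: (mulIg (f x)); rewrite mulVg -epiM mulVg epi1. Qed.

Section OpenQuotients.
Variables (U : finGrp -> Prop) (G : topologicalGroupType).

Definition epi_ker (Q : groupType) (q : epi G Q) : set G :=
  [set x | q x = 1%g].

Lemma epi_ker_normal (Q : groupType) (q : epi G Q) : is_normal (epi_ker q).
Proof.
split; first split=> [|x y|x]; rewrite /epi_ker /=.
- exact: epi1.
- by rewrite epiM => -> ->; rewrite mulg1.
- by rewrite epiV => ->; rewrite invg1.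
- by move=> x y; rewrite /epi_ker /= epiJ => ->; rewrite conj1g.
Qed.

(** The quotient [quo N] is an arbitrary choice, while quotients obtained by composing or pulling
    back need not be the chosen ones. This record allows any of them; [uq_of] and [NN_of] translate
    to and from the index set of the colimit. *)
Record uquotient := UQuotient {
  uq_ob : fullsub U;
  uq_proj : epi G (sval uq_ob);
  uq_open : open (epi_ker uq_proj) }.

(** Commutation under [G] is strict, not up to conjugacy, which makes such an [r] unique and the
    system of quotients a directed poset up to equivalence. *)
Definition uq_over (q' q : uquotient) (r : hom (uq_ob q') (uq_ob q)) : Prop :=
  forall x, r (uq_proj q' x) = uq_proj q x.

Lemma uq_over_unique q' q (r r' : hom (uq_ob q') (uq_ob q)) :
  uq_over r -> uq_over r' -> r =h r'.
Proof.
move=> rq rq'; exists 1%g => y; have [x <-] := epi_surj (uq_proj q') y.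
by rewrite conjg1 rq rq'.
Qed.

Lemma uq_over_comp q3 q2 q1 (r : hom (uq_ob q2) (uq_ob q1))
    (r' : hom (uq_ob q3) (uq_ob q2)) :
  uq_over r -> uq_over r' -> uq_over (r \oh r').
Proof. by move=> rq rq' x; rewrite /= rq' rq. Qed.

Lemma uq_over_exists q' q :
    epi_ker (uq_proj q') `<=` epi_ker (uq_proj q) ->
  exists r : hom (uq_ob q') (uq_ob q), uq_over r.
Proof. by move=> sub; apply: epi_factor. Qed.

Lemma uq_over_ker q' q (r : hom (uq_ob q') (uq_ob q)) :
  uq_over r -> epi_ker (uq_proj q') `<=` epi_ker (uq_proj q).
Proof. by move=> rq x; rewrite /epi_ker /= -rq => ->; rewrite epi1. Qed.

Lemma quo_open (N : {N : set G | NN U N}) : open (epi_ker (fq_proj (quo N))).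
Proof.
have -> : epi_ker (fq_proj (quo N)) = sval N.
  by apply/seteqP; split=> x; rewrite /epi_ker /= (fq_ker (quo N)).
by have [] := proj2_sig N.
Qed.

Definition uq_of (N : {N : set G | NN U N}) : uquotient :=
  UQuotient (quo_open N).

Lemma NN_ker (q : uquotient) : NN U (epi_ker (uq_proj q)).
Proof.
split; [exact: uq_open|exact: epi_ker_normal|constructor].
by exists (uq_ob q) (uq_proj q).
Qed.

Definition NN_of (q : uquotient) : {N : set G | NN U N} := exist _ _ (NN_ker q).

Lemma uq_of_ker N : epi_ker (uq_proj (uq_of N)) = sval N.
Proof. by apply/seteqP; split=> x; rewrite /epi_ker /= (fq_ker (quo N)). Qed.

Lemma uq_of_NN q :
  (exists r : hom (uq_ob (uq_of (NN_of q))) (uq_ob q), uq_over r) /\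
  (exists r : hom (uq_ob q) (uq_ob (uq_of (NN_of q))), uq_over r).
Proof.
by split; apply: uq_over_exists; rewrite uq_of_ker; exact: subset_refl.
Qed.

Hypothesis GU : in_profinite_extension U G.

Lemma open_normal_uquotient (M : set G) : open M -> is_normal M ->
  exists q : uquotient, epi_ker (uq_proj q) `<=` M.
Proof.
move=> oM nM; have [_ _ /(_ M oM nM)[N NU NM]] := GU.
by exists (uq_of (exist _ N NU)); rewrite uq_of_ker.
Qed.

Lemma uquotient_inhabited : inhabited uquotient.
Proof.
have [||q _] := @open_normal_uquotient setT; last by constructor.
  exact: openT.
by split.
Qed.

Lemma uq_directed (q1 q2 : uquotient) : exists q (r1 : hom (uq_ob q) (uq_ob q1))
  (r2 : hom (uq_ob q) (uq_ob q2)), uq_over r1 /\ uq_over r2.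
Proof.
have [||q qI] := @open_normal_uquotient (epi_ker (uq_proj q1) `&` epi_ker
  (uq_proj q2)).
- by apply: openI; exact: uq_open.
- have [[a1 aM aV] aJ] := epi_ker_normal (uq_proj q1).
  have [[b1 bM bV] bJ] := epi_ker_normal (uq_proj q2).
  split; first split.
  + by [].
  + by move=> x y [? ?] [? ?]; split; [exact: aM|exact: bM].
  + by move=> x [? ?]; split; [exact: aV|exact: bV].
  + by move=> x y [? ?]; split; [exact: aJ|exact: bJ].
have [r1 r1P] : exists r : hom (uq_ob q) (uq_ob q1), uq_over r.
  by apply: uq_over_exists => x /qI [].
have [r2 r2P] : exists r : hom (uq_ob q) (uq_ob q2), uq_over r.
  by apply: uq_over_exists => x /qI [].
by exists q, r1, r2.
Qed.

Section Colimit.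
Variables (k : fieldType) (F : presheaf k (fullsub U)).

Definition dies (q : uquotient) (x : F (uq_ob q)) : Prop :=
  exists q' (r : hom (uq_ob q') (uq_ob q)), uq_over r /\ pmap F r x = 0.

Lemma dies_pmap q' q (r : hom (uq_ob q') (uq_ob q)) (x : F (uq_ob q)) :
  uq_over r -> dies x <-> dies (pmap F r x).
Proof.
move=> rq; split=> [[q1 [r1 [rq1 x0]]]|[q1 [r1 [rq1 x0]]]]; last first.
  exists q1, (r \oh r1); split; first exact: uq_over_comp.
  by rewrite pmap_comp.
have [q2 [s [s' [sq sq']]]] := uq_directed q1 q'.
exists q2, s'; split=> //.
rewrite -[LHS]/((pmap F s' \o pmap F r) x) -pmap_comp.
rewrite (pmap_eq (g := r1 \oh s)) ?pmap_comp /= ?x0 ?linear0//.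
by apply: uq_over_unique; exact: uq_over_comp.
Qed.

Let idx := {N : set G | NN U N}.
Let V (N : idx) : lmodType k := F (fq_ob (quo N)).

Let transport (N' N : idx) (x : V N) : V N' :=
  match pselect (exists r : hom (uq_ob (uq_of N')) (uq_ob (uq_of N)),
    uq_over r) with
  | left h => pmap F (projT1 (cid h)) x
  | right _ => 0
  end.

Lemma transportE (N' N : idx) (r : hom (uq_ob (uq_of N')) (uq_ob (uq_of N))) x :
  uq_over r -> transport N' x = pmap F r x.
Proof.
move=> rq; rewrite /transport; case: pselect => [h|[]]; last by exists r.
apply: pmap_eq; apply: uq_over_unique rq; exact: (projT2 (cid h)).
Qed.

Let germ (p : {N : idx & V N}) : idx -> dirsum V :=
  fun N' => dirsum_in (transport N' (projT2 p)).

Lemma colim_in_eq0 (N : idx) (x : V N) :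
  colim_in (@quo_transition k U G F) x = 0 -> dies (q := uq_of N) x.
Proof.
move=> x0.
pose B (f : idx -> dirsum V) :=
  exists N1 : idx, forall N2 : idx, sval N2 `<=` sval N1 -> f N2 = 0.
have [N0 _] : exists N0 : idx, True by exists N.
have [||p pB] := @subspace_is_kernel k (idx -> dirsum V : lmodType k) B.
- by exists N0.
- move=> c f g [N1 f0] [N2 g0].
  have [q [r1 [r2 [/uq_over_ker + /uq_over_ker]]]] :=
    uq_directed (uq_of N1) (uq_of N2).
  rewrite !uq_of_ker => qN1 qN2; exists (NN_of q) => N3 N3q.
  rewrite -[LHS]/(c *: f N3 + g N3) f0 ?g0 ?scaler0 ?addr0//.
    exact: subset_trans qN2.
  exact: subset_trans qN1.
have pk : kills (colim_rel (@quo_transition k U G F)) (fun t => p (germ t)).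
  move=> _ [i c y z|i j t y [rho [rhoP tE]]].
    apply/fsum_lin; rewrite -linearP; congr (p _); apply/funext => N'.
    rewrite -[RHS]/(c *: germ (existT _ i y) N' + germ (existT _ i z) N').
    rewrite /germ /= -dirsum_in_linear; congr dirsum_in; rewrite /transport.
    by case: pselect => ?; rewrite ?linearP// scaler0 addr0.
  apply/fsum_eqr/eqP; rewrite -subr_eq0 -linearB; apply/eqP/pB.
  exists j => N2 N2j; rewrite -[LHS]/(germ _ N2 - germ _ N2) /germ /=.
  have [r rq] : exists r : hom (uq_ob (uq_of N2)) (uq_ob (uq_of j)), uq_over r.
    by apply: uq_over_exists; rewrite !uq_of_ker.
  have rho_over : @uq_over (uq_of j) (uq_of i) rho by [].
  rewrite (transportE _ rq) (transportE _ (uq_over_comp rho_over rq)).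
  by rewrite tE pmap_comp subrr.
have : p (germ (existT _ N x)) = 0.
  by rewrite -(plift_gen pk) -[pgen _ _]/(colim_in _ x) x0 linear0.
move=> /pB [N1 N1P].
have [q [r1 [r2 [r1q r2q]]]] := uq_directed (uq_of N1) (uq_of N).
have [[s sq] _] := uq_of_NN q.
exists (uq_of (NN_of q)), (r2 \oh s); split; first exact: uq_over_comp.
have /(congr1 (dirsum_proj V (NN_of q))) : germ (existT _ N x) (NN_of q) = 0.
  by apply: N1P; rewrite -(uq_of_ker N1); exact: uq_over_ker r1q.
by rewrite linear0 dirsum_projK /= (transportE _ (uq_over_comp r2q sq)).
Qed.

Lemma colim_quotients_eq0 :
  (forall c : colim_quotients G F, c = 0) <->
  (forall (q : uquotient) (x : F (uq_ob q)), dies x).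
Proof.
split=> [c0 q x|dF].
  have [[r rq] _] := uq_of_NN q.
  by apply/(dies_pmap _ rq)/colim_in_eq0.
apply: (@pres_ext k _ _ _ idfun \0) => -[N x] /=.
have [q [r [rq x0]]] := dF (uq_of N) x.
have [[s sq] _] := uq_of_NN q.
pose t : {linear V N -> V (NN_of q)} := pmap F (r \oh s).
have tP : quo_transition t by exists (r \oh s); split=> //;
  exact: (uq_over_comp (q1 := uq_of N) rq sq).
have /(fsum_eqr (pgen _)) -> := pgen_kills (colim_transition x tP).
have -> : t x = 0 by rewrite /t pmap_comp /= x0 linear0.
have := @colim_in_linear k _ _ (@quo_transition k U G F) (NN_of q) (-1) 0 0.
by rewrite scaler0 addr0 scaleN1r addNr.
Qed.

End Colimit.

End OpenQuotients.

(** * Group primes are prime thick ideals *)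

Lemma pres_ind (k : fieldType) (S : Type) (Rel : seq (k * S) -> Prop)
    (P : pres Rel -> Prop) :
    P 0 -> (forall c x u, P u -> P (c *: pgen Rel x + u)) ->
  forall u, P u.
Proof.
move=> P0 Padd u.
have -> : u = pres_of Rel (pres_repr u).
  by apply: pres_eqP => W f fR; rewrite pres_evE.
rewrite pres_ofE /fsum; elim: (pres_repr u) => [|[c x] s IH].
  by rewrite big_nil.
by rewrite big_cons; exact: Padd.
Qed.

Section ConeDifferential.
Variables (k : fieldType) (C : category) (X Y : complex k C) (f : cmap X Y).

Lemma cm_at_cd i l j a (x : X i a) : l = j ->
  cm_at f l j a (cd X i l a x) = cd Y i j a (f i a x).
Proof. by move=> <-; rewrite cm_atE cm_cd. Qed.

Lemma cd_cm_at i l j a (x : X i a) : i = l ->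
  cd Y l j a (cm_at f i l a x) = f j a (cd X i j a x).
Proof. by move=> <-; rewrite cm_atE cm_cd. Qed.

Lemma cone_cdE i j a (p : cone f i a) : cd (cone f) i j a p =
  (- cd X (i - 1) (j - 1) a p.1, cm_at f (i - 1) j a p.1 + cd Y i j a p.2).
Proof. exact: cone_linE. Qed.

Lemma cone_pmapE i a b (u : hom a b) (p : cone f i b) :
  pmap (cone f i) u p = (pmap (X (i - 1)) u p.1, pmap (Y i) u p.2).
Proof. exact: prod_pmapE. Qed.

End ConeDifferential.

Lemma boundary_at (k : fieldType) (C : category) (X : complex k C) n a i
    (x : X n a) : i = n + 1 -> boundary x -> exists y, x = cd X i n a y.
Proof. by move=> ->. Qed.

(** * Splitting a complex of vector spaces, and its effect on tensor products *)

Section Homotopy.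
Variables (k : fieldType) (C : category) (X Y : complex k C) (a : C).

(** Chosen separately at each object, hence not natural in [a]; the whole section stays at one
    object. *)
Definition back i j : {linear X i a -> X j a} :=
  projT1 (cid (linear_generalized_inverse (cd X j i a))).

Lemma cd_back i j x : cd X j i a (back i j (cd X j i a x)) = cd X j i a x.
Proof. exact: (projT2 (cid (linear_generalized_inverse (cd X j i a)))). Qed.

(* Since [d s d = d] for [s = back], this is a projection onto a complement of
   the boundaries in the cycles, homotopic to the identity. *)
Definition hproj i : {linear X i a -> X i a} :=
  ((idfun \- (cd X (i + 1) i a \o back i (i + 1)))
    \- (back (i - 1) i \o cd X i (i - 1) a))%R.

Lemma hprojE i x : hproj i x =
  x - cd X (i + 1) i a (back i (i + 1) x) - back (i - 1) i (cd X i (i - 1) a x).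
Proof. by []. Qed.

Lemma cd_hproj i j x : cd X i j a (hproj i x) = 0.
Proof.
have [ij|ij] := pselect (i = j + 1); last by rewrite cd_shape.
have {ij} ji : j = i - 1 by lia.
by subst j; rewrite hprojE !linearB cd_cd subr0 cd_back subrr.
Qed.

Lemma hproj_cd i l x : hproj i (cd X l i a x) = 0.
Proof.
have [li|li] := pselect (l = i + 1); last by rewrite cd_shape// linear0.
by subst l; rewrite hprojE cd_back subrr cd_cd linear0 subr0.
Qed.

(** Needed because degrees such as [i + 1 - 1] and [i] are equal without being convertible. *)
Lemma tens_reindex n i i' j (e : i + j = n) (e' : i' + j = n)
    (g : forall l, X l a) (y : Y j a) :
  i = i' -> tens e (g i) y = tens e' (g i') y.
Proof. by move=> ii'; subst i'; rewrite (Prop_irrelevance e e'). Qed.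

Lemma tens_hproj_linearl n i j (e : i + j = n) (y : Y j a) :
  linear (fun x : X i a => tens e (hproj i x) y).
Proof. by move=> c x x'; rewrite linearP; exact: tens_linearl. Qed.

Definition tens_hproj n : {linear tensor X Y n a -> tensor X Y n a} :=
  tensor_lift (b := fun i j e x y => tens e (hproj i x) y)
    (@tens_hproj_linearl n) (fun i j e x => tens_linearr e (hproj i x)).

Lemma tens_hprojE n i j (e : i + j = n) x (y : Y j a) :
  tens_hproj n (tens e x y) = tens e (hproj i x) y.
Proof. exact: tensor_liftE. Qed.

Lemma deg_up i j n m : i + j = n -> m = n + 1 -> i + 1 + j = m :> int.
Proof. lia. Qed.

Lemma tens_back_linearl n m (nm : m = n + 1) i j (e : i + j = n) (y : Y j a) :
  linear (fun x : X i a => tens (deg_up e nm) (back i (i + 1) x) y).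
Proof. by move=> c x x'; rewrite linearP; exact: tens_linearl. Qed.

Definition tens_back n m (nm : m = n + 1) :
    {linear tensor X Y n a -> tensor X Y m a} :=
  tensor_lift (b := fun i j e x y => tens (deg_up e nm) (back i (i + 1) x) y)
    (@tens_back_linearl n m nm)
    (fun i j e x => tens_linearr (deg_up e nm) (back i (i + 1) x)).

Lemma tens_backE n m (nm : m = n + 1) i j (e : i + j = n) x (y : Y j a) :
  tens_back nm (tens e x y) = tens (deg_up e nm) (back i (i + 1) x) y.
Proof. exact: tensor_liftE. Qed.

Lemma tensor_cdE n m i j (e : i + j = n) (x : X i a) (y : Y j a)
    (nm : n = m + 1) :
  cd (tensor X Y) n m a (tens e x y)
  = tens (deg_l e nm) (cd X i (i - 1) a x) y
    + (-1) ^ i *: tens (deg_r e nm) x (cd Y j (j - 1) a y).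
Proof.
rewrite [LHS]tensor_dE /tensor_d_fun; case: eqP => // nm'.
by rewrite (Prop_irrelevance nm nm').
Qed.

(** With [s = back], the homotopy [id - hproj = d s + s d] is tensored with the identity of [Y]. The
    two terms [s x @ d y] carry the signs (-1)^(i + 1) and (-1)^i and cancel. *)
Lemma tens_hproj_homotopy n (e1 : n + 1 = n + 1) (e2 : n = n - 1 + 1) t :
  t = tens_hproj n t + cd (tensor X Y) (n + 1) n a (tens_back e1 t)
      + tens_back e2 (cd (tensor X Y) n (n - 1) a t).
Proof.
pose F : {linear tensor X Y n a -> tensor X Y n a} :=
  ((tens_hproj n \+ (cd (tensor X Y) (n + 1) n a \o tens_back e1))
   \+ (tens_back e2 \o cd (tensor X Y) n (n - 1) a))%R.
suff: (idfun : {linear tensor X Y n a -> tensor X Y n a}) =1 F by exact.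
apply: tensor_ext => i j e x y; rewrite -[LHS]/(tens e x y).
rewrite -[RHS]/(tens_hproj n _ + cd (tensor X Y) (n + 1) n a (tens_back e1 _)
  + tens_back e2 (cd (tensor X Y) n (n - 1) a _)).
rewrite tens_hprojE tens_backE (tensor_cdE _ _ _ e1) (tensor_cdE _ _ _ e2).
rewrite linearD linearZ !tens_backE.
have deg0 : i + 1 - 1 = i by lia.
have deg1 : i - 1 + 1 = i by lia.
rewrite (tens_reindex _ e (fun l => cd X (i + 1) l a (back i (i + 1) x)) y
  deg0).
rewrite (tens_reindex _ e (fun l => back (i - 1) l (cd X i (i - 1) a x)) y
  deg1).
set A := tens e (cd _ _ _ _ _) y; set B := tens e (back _ _ _) y.
set T1 := tens _ _ (cd Y _ _ _ _); set T2 := tens _ _ (cd Y _ _ _ _).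
have -> : T1 = T2 by congr (tens _ _ _); exact: Prop_irrelevance.
have -> : tens e (hproj i x) y = tens e x y - A - B.
  rewrite hprojE; have lin := @tens_linearl k C X Y n a i j e y.
  have := lin (-1) (back (i - 1) i (cd X i (i - 1) a x))
    (x - cd X (i + 1) i a (back i (i + 1) x)).
  rewrite !scaleN1r [- _ + _]addrC => ->; rewrite addrC -/B; congr (_ - _).
  have := lin (-1) (cd X (i + 1) i a (back i (i + 1) x)) x.
  by rewrite !scaleN1r [- _ + _]addrC => ->; rewrite addrC.
rewrite expfzDr ?oppr_eq0 ?oner_eq0// expr1z mulrN1 scaleNr.
by rewrite -[X in B + X]/((-1) ^ i *: T2) addrACA !subrK.
Qed.

Lemma tens_hproj_boundary n (t : tensor X Y n a) :
  (forall j, cd (tensor X Y) n j a t = 0) -> boundary (t - tens_hproj n t).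
Proof.
move=> tZ; have e : n = n - 1 + 1 by lia.
rewrite {1}(tens_hproj_homotopy erefl e t) tZ linear0 addr0 addrAC subrr add0r.
exact: cd_boundary.
Qed.

End Homotopy.

Section GroupPrime.
Variables (k : fieldType) (U : finGrp -> Prop) (G : topologicalGroupType).
Hypothesis GU : in_profinite_extension U G.
Implicit Types (X Y : complex k (fullsub U)) (q : uquotient U G).

Definition bdies X n q (x : X n (uq_ob q)) : Prop :=
  exists q' (r : hom (uq_ob q') (uq_ob q)),
    uq_over r /\ boundary (pmap (X n) r x).

Definition hvanishes X : Prop :=
  forall n q (x : X n (uq_ob q)), (forall j, cd X n j _ x = 0) -> bdies x.

Lemma cycle_bdies X n q (z : cycle X n (uq_ob q)) :
  bdies (sval z) <-> dies (F := homology X n) (hclass z).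
Proof.
split=> -[q' [r [rq bz]]]; exists q', r; split=> //.
  by rewrite homology_pmapE; apply/hclass_eq0.
by move: bz; rewrite homology_pmapE => /hclass_eq0.
Qed.

Lemma hvanishesP X :
  hvanishes X <-> forall n q (x : homology X n (uq_ob q)), dies x.
Proof.
split=> [vX n q x|dX n q x xZ].
  have [z ->] := hclass_surj x; apply/cycle_bdies; exact: vX (proj2_sig z).
by apply/(@cycle_bdies X n q (exist _ x xZ)).
Qed.

Lemma group_prime_hvanishes (X : derived_compact k (fullsub U)) :
  group_prime G X = hvanishes (dc_obj X).
Proof.
apply/propext; rewrite hvanishesP; split=> dX n;
  first exact/(colim_quotients_eq0 GU).
by apply/(colim_quotients_eq0 GU); exact: dX.
Qed.

Lemma hvanishes_retract X Y (i : dhom X Y) (r : dhom Y X) :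
  deq (dcomp r i) (dmap (cm_id X)) -> hvanishes Y -> hvanishes X.
Proof.
move=> /hmap_deq ri /hvanishesP dY; apply/hvanishesP => n q x.
have [q' [s [sq x0]]] := dY n q (hmap i n _ x).
exists q', s; split=> //.
have -> : x = hmap r n _ (hmap i n _ x).
  rewrite -[RHS]/(hmap (dcomp r i) n _ x) ri; have [z ->] := hclass_surj x.
  by rewrite [RHS]homology_mapE; congr hclass; apply: cycle_inj.
by rewrite -hmap_nat x0 linear0.
Qed.

Lemma hvanishes_iso X Y : @iso (derived k (fullsub U)) X Y ->
  hvanishes X = hvanishes Y.
Proof.
move=> [f [g [gf fg]]]; apply/propext.
by split; [exact: hvanishes_retract fg|exact: hvanishes_retract gf].
Qed.

Lemma bdies_pmap X n q' q (r : hom (uq_ob q') (uq_ob q)) (x : X n (uq_ob q)) :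
  uq_over r -> bdies (pmap (X n) r x) -> bdies x.
Proof.
move=> rq [q1 [r1 [r1q b]]]; exists q1, (r \oh r1).
by split; [exact: uq_over_comp|rewrite pmap_comp].
Qed.

Lemma cycle_pmap_cd X n a b (r : hom a b) (x : X n b) :
  (forall j, cd X n j b x = 0) -> forall j, cd X n j a (pmap (X n) r x) = 0.
Proof. by move=> xZ j; rewrite pm_nat xZ linear0. Qed.

Section Cone.
Variables (X Y : complex k (fullsub U)) (f : cmap X Y).

Lemma hvanishes_cone : hvanishes X -> hvanishes Y -> hvanishes (cone f).
Proof.
move=> vX vY n q p pZ.
have p1Z j : cd X (n - 1) j _ p.1 = 0.
  have := pZ (j + 1); rewrite cone_cdE => -[/eqP + _].
  by rewrite oppr_eq0 addrK => /eqP.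
have [q1 [r1 [r1q /(boundary_at (i := n + 1 - 1)) []]]] := vX _ _ _ p1Z.
  by lia.
move=> w wE.
apply: (bdies_pmap r1q); rewrite cone_pmapE wE.
set y := pmap (Y n) r1 p.2.
have yZ j : cm_at f (n - 1) j _ (cd X (n + 1 - 1) (n - 1) _ w) + cd Y n j _ y
  = 0.
  have := cycle_pmap_cd r1 pZ j; rewrite cone_cdE cone_pmapE wE.
  by case=> _.
have n1 : n + 1 - 1 = n by lia.
(* The second component alone need not be a cycle; adding the image of [w] makes it one. If it is
   then the boundary of [u], the pair [(- w, u)] bounds the given cycle of the cone. *)
have vZ j : cd Y n j _ (y + cm_at f (n + 1 - 1) n _ w) = 0.
  rewrite linearD cd_cm_at// -(yZ j) addrC; congr (_ + _).
  have [jn|jn] := pselect (n - 1 = j); first by subst j; rewrite cm_atE.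
  by rewrite cm_at_neq// cd_shape ?linear0//; lia.
have [q2 [r2 [r2q [u uE]]]] := vY _ _ _ vZ.
exists q2, r2; split=> //; rewrite cone_pmapE.
have -> : (pmap (X (n - 1)) r2 (cd X (n + 1 - 1) (n - 1) _ w), pmap (Y n) r2 y)
    = cd (cone f) (n + 1) n _ (- pmap (X (n + 1 - 1)) r2 w, u).
  rewrite cone_cdE /= !linearN opprK pm_nat -uE linearD pm_nat.
  by congr pair; rewrite [RHS]addrC addrK.
exact: cd_boundary.
Qed.

(** Once [f x = d u], the pair [(x, - u)] is a cycle of the cone, and the first component of what
    bounds it bounds [x] up to sign. *)
Lemma hvanishes_cone_source : hvanishes Y -> hvanishes (cone f) -> hvanishes X.
Proof.
move=> vY vC.
(* Reindexed so that [x] has degree [m - 1], the shift found in degree [m] of the cone. *)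
suff H m q (x : X (m - 1) (uq_ob q)) : (forall j, cd X (m - 1) j _ x = 0) ->
  bdies x.
  by move=> n; have := H (n + 1); rewrite addrK.
move=> xZ.
have fxZ j : cd Y (m - 1) j _ (f (m - 1) _ x) = 0 by rewrite -cm_cd xZ linear0.
have [q1 [r1 [r1q /(boundary_at (i := m)) []]]] := vY _ _ _ fxZ; first by lia.
move=> u uE; apply: (bdies_pmap r1q).
have pZ j : cd (cone f) m j _ (pmap (X (m - 1)) r1 x, - u) = 0.
  rewrite cone_cdE /= (cycle_pmap_cd r1 xZ) oppr0 linearN; congr pair.
  have [jm|jm] := pselect (m - 1 = j).
    by subst j; rewrite cm_atE pm_nat uE subrr.
  by rewrite cm_at_neq// cd_shape ?subrr//; lia.
have [q2 [r2 [r2q [w]]]] := vC _ _ _ pZ.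
rewrite cone_pmapE cone_cdE => -[wE _].
by exists q2, r2; split=> //; rewrite wE -linearN; exact: cd_boundary.
Qed.

(** If [(0, y)] bounds by [(w, u)], then [w] is a cycle and [y = f w + d u]; once [w] is a boundary,
    so is [y]. *)
Lemma hvanishes_cone_target : hvanishes X -> hvanishes (cone f) -> hvanishes Y.
Proof.
move=> vX vC n q y yZ.
have pZ j : cd (cone f) n j _ (0, y) = 0.
  by rewrite cone_cdE /= !linear0 yZ addr0.
have [q1 [r1 [r1q [[w u]]]]] := vC _ _ _ pZ.
rewrite cone_pmapE cone_cdE /= linear0 => -[/esym/eqP].
rewrite oppr_eq0 => /eqP w0 yE.
have wZ j : cd X (n + 1 - 1) j _ w = 0.
  have [jn|jn] := pselect (j = n - 1); first by subst j.
  by rewrite cd_shape//; lia.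
have [q2 [r2 [r2q [t tE]]]] := vX _ _ _ wZ.
apply: (bdies_pmap r1q); exists q2, r2; split=> //.
rewrite yE linearD -!pm_nat tE cm_at_cd; last by lia.
rewrite -[X in boundary (X + _)]scale1r.
by apply: boundary_lin; exact: cd_boundary.
Qed.

End Cone.

Section Tensor.
Variables X Y : complex k (fullsub U).

(* [u] lies in the span of the [d w @ y]. *)
Definition bspan n a (u : tensor X Y n a) : Prop :=
  forall (W : lmodType k) (phi : {linear tensor X Y n a -> W}),
    (forall i j (e : i + j = n) l (w : X l a) (y : Y j a),
       phi (tens e (cd X l i a w) y) = 0) ->
    phi u = 0.

Lemma bspan_lin n a c (u v : tensor X Y n a) :
  bspan u -> bspan v -> bspan (c *: u + v).
Proof.
by move=> bu bv W phi phi0; rewrite linearP bu// bv// scaler0 addr0.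
Qed.

Lemma bspan_pmap n a b (r : hom a b) (u : tensor X Y n b) :
  bspan u -> bspan (pmap (tensor X Y n) r u).
Proof.
move=> bu W phi phi0; apply: (bu _ (phi \o pmap (tensor X Y n) r)%R).
move=> i j e l w y; rewrite -[LHS]/(phi (tensor_pmap X Y n r _)).
by rewrite tensor_pmapE -pm_nat phi0.
Qed.

Definition sdies n q (u : tensor X Y n (uq_ob q)) : Prop :=
  exists q' (r : hom (uq_ob q') (uq_ob q)),
    uq_over r /\ bspan (pmap (tensor X Y n) r u).

Lemma sdies_lin n q c (u v : tensor X Y n (uq_ob q)) :
  sdies u -> sdies v -> sdies (c *: u + v).
Proof.
move=> [q1 [r1 [r1q bu]]] [q2 [r2 [r2q bv]]].
have [q3 [s1 [s2 [s1q s2q]]]] := uq_directed GU q1 q2.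
exists q3, (r1 \oh s1); split; first exact: uq_over_comp.
rewrite linearP; apply: bspan_lin; first by rewrite pmap_comp;
  exact: bspan_pmap.
rewrite (pmap_eq (g := r2 \oh s2)) ?pmap_comp; first exact: bspan_pmap.
by apply: uq_over_unique; exact: uq_over_comp.
Qed.

(** Each [hproj i x] is a cycle, so it becomes a boundary further down; directedness brings finitely
    many symbols to a common stage. *)
Lemma sdies_hproj n q (t : tensor X Y n (uq_ob q)) :
  hvanishes X -> sdies (tens_hproj X Y _ n t).
Proof.
move=> vX; move: t; apply: pres_ind => [|c [i j e x y] u IH].
  rewrite linear0; exists q, (idh _); split=> //.
  by move=> W phi _; rewrite !linear0.
rewrite linearP; apply: sdies_lin => //.
rewrite -[pgen _ _]/(tens e x y) tens_hprojE.
have [q' [r [rq [w wE]]]] := vX i q _ (fun l => cd_hproj l x).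
exists q', r; split=> // W phi phi0.
by rewrite -[pmap _ _ _]/(tensor_pmap X Y n r _) tensor_pmapE wE phi0.
Qed.

(** The cycle [t] is homologous to its projection, which further down lies in the span of the
    [d w @ y]. As the projections at [q] and at [q'] are unrelated, a second projection is applied
    at [q']: it kills that span, so the restricted first projection is itself a boundary. *)
Lemma hvanishes_tensor : hvanishes X -> hvanishes (tensor X Y).
Proof.
move=> vX n q t tZ.
have [q' [r [rq bs]]] := sdies_hproj t vX.
exists q', r; split=> //.
have b1 := boundary_pmap r (tens_hproj_boundary tZ).
have bZ a (x : tensor X Y n a) : boundary x ->
  forall j, cd (tensor X Y) n j a x = 0.
  by move=> [y ->] j; rewrite cd_cd.
have uZ j : cd (tensor X Y) n j _ (pmap (tensor X Y n) r (tens_hproj X Y _ n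
  t)) = 0.
  have := bZ _ _ b1 j; rewrite linearB linearB (cycle_pmap_cd r tZ) sub0r.
  by move/eqP; rewrite oppr_eq0 => /eqP.
have b2 := tens_hproj_boundary uZ.
rewrite (bs _ (tens_hproj X Y _ n)) ?subr0 in b2; last first.
  by move=> i j e l w y; rewrite tens_hprojE hproj_cd tens0l.
rewrite -[t](subrK (tens_hproj X Y _ n t)) linearD -[X in boundary (X +
  _)]scale1r.
exact: boundary_lin.
Qed.

(** Functionals killing the boundaries, with value 1 at [x] and at [y], multiply to a functional on
    the tensor product that kills boundaries and has value 1 at [x @ y]. *)
Lemma tens_not_boundary n m a (x : X n a) (y : Y m a) :
  ~ boundary x -> ~ boundary y ->
  ~ boundary (tens (erefl (n + m)) x y : tensor X Y (n + m) a).
Proof.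
move=> nx ny.
have [phi [phi1 phi0]] := functional_separates (boundary0 X n a)
  (@boundary_lin _ _ X n a) nx.
have [psi [psi1 psi0]] := functional_separates (boundary0 Y m a)
  (@boundary_lin _ _ Y m a) ny.
(* Extension by zero to the other degrees, since total degree [n + m] contains symbols of every
   bidegree. *)
pose f i (u : X i a) : k := phi (@tag_at k int (fun i => X i a) n (existT _ i
  u)).
pose g i (u : Y i a) : k := psi (@tag_at k int (fun i => Y i a) m (existT _ i
  u)).
have f_lin i c (u u' : X i a) : f i (c *: u + u') = c * f i u + f i u'.
  by rewrite /f tag_at_linear linearP.
have g_lin i c (u u' : Y i a) : g i (c *: u + u') = c * g i u + g i u'.
  by rewrite /g tag_at_linear linearP.
have f_cd i l (u : X i a) : f l (cd X i l a u) = 0.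
  rewrite /f; have [ln|ln] := pselect (l = n);
    last by rewrite tag_at_neq// linear0.
  by subst l; rewrite tag_atE; apply: phi0; exact: cd_boundary.
have g_cd i l (u : Y i a) : g l (cd Y i l a u) = 0.
  rewrite /g; have [ln|ln] := pselect (l = m);
    last by rewrite tag_at_neq// linear0.
  by subst l; rewrite tag_atE; apply: psi0; exact: cd_boundary.
pose b i j (e : i + j = n + m) (u : X i a) (v : Y j a) : k^o := f i u * g j v.
have bl i j (e : i + j = n + m) v : linear (fun u => b i j e u v).
  by move=> c u u'; rewrite /b f_lin mulrDl -mulrA.
have br i j (e : i + j = n + m) u : linear (fun v => b i j e u v).
  by move=> c v v'; rewrite /b g_lin mulrDr mulrCA.
pose h := tensor_lift bl br.
have hd t : h (cd (tensor X Y) (n + m + 1) (n + m) a t) = 0.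
  move: t; apply: (@tensor_ext _ _ _ _ _ _ _ (h \o cd (tensor X Y) (n + m + 1)
    (n + m) a)%R \0).
  move=> i j e u v; rewrite -[LHS]/(h (cd (tensor X Y) (n + m + 1) (n + m) a
    _)).
  rewrite (tensor_cdE _ _ _ erefl).
  rewrite linearD linearZ !tensor_liftE /b f_cd g_cd mul0r mulr0 add0r.
  exact: scaler0.
move=> [t tE]; have := hd t; rewrite -tE tensor_liftE /b /f /g !tag_atE phi1
  psi1.
by rewrite mulr1 => /eqP; rewrite oner_eq0.
Qed.

(** Surviving cycles of [X] and [Y], moved to a common stage, stay non-boundaries at every later
    stage; hence so does their tensor product. *)
Lemma hvanishes_tensor_prime :
  hvanishes (tensor X Y) -> hvanishes X \/ hvanishes Y.
Proof.
move=> vT; apply: contrapT => /not_orP[vX vY].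
have [n [q1 [x [xZ nx]]]] : exists n q (x : X n (uq_ob q)),
    (forall j, cd X n j _ x = 0) /\ ~ bdies x.
  apply: contrapT => h; apply: vX => n q x xZ; apply: contrapT => nx.
  by apply: h; exists n, q, x.
have [m [q2 [y [yZ ny]]]] : exists n q (x : Y n (uq_ob q)),
    (forall j, cd Y n j _ x = 0) /\ ~ bdies x.
  apply: contrapT => h; apply: vY => m q y yZ; apply: contrapT => ny.
  by apply: h; exists m, q, y.
have [q3 [r1 [r2 [r1q r2q]]]] := uq_directed GU q1 q2.
pose x3 := pmap (X n) r1 x; pose y3 := pmap (Y m) r2 y.
have [|q4 [r [rq]]] := vT (n + m) q3 (tens erefl x3 y3).
  move=> j; have [e|e] := pselect (n + m = j + 1); last by rewrite cd_shape.
  rewrite (tensor_cdE _ _ _ e) !cycle_pmap_cd// tens0l tens0r.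
  by rewrite scaler0 addr0.
rewrite -[pmap _ _ _]/(tensor_pmap X Y (n + m) r _) tensor_pmapE.
apply: tens_not_boundary => b.
  by apply: nx; apply: (bdies_pmap r1q); exists q4, r.
by apply: ny; apply: (bdies_pmap r2q); exists q4, r.
Qed.

End Tensor.

Lemma hvanishes_zero : hvanishes (zero_complex k (fullsub U)).
Proof.
move=> n q x _; exists q, (idh _); split=> //.
by rewrite [x]thinmx0 linear0; exact: boundary0.
Qed.

Lemma not_hvanishes_unit : ~ hvanishes (unit_complex k (fullsub U)).
Proof.
move=> vU; have [q] := uquotient_inhabited GU.
have [//|q' [r [_ [y]]]] := vU 0 q (const_mx 1 : 'rV[k]_1).
move=> /(congr1 (fun M : 'rV[k]_1 => M 0 0)).
by rewrite !mxE => /eqP; rewrite oner_eq0.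
Qed.

Lemma group_prime_ideal :
  compact_object (unit_complex k (fullsub U)) ->
  prime_thick_ideal (@group_prime k U G).
Proof.
move=> unitc; split.
- by move=> X Y /hvanishes_iso XY; rewrite !group_prime_hvanishes XY.
- move=> Z /hvanishes_iso ZE; rewrite group_prime_hvanishes ZE.
  exact: hvanishes_zero.
- move=> X Y Z [X' [Y' [f [/hvanishes_iso XE /hvanishes_iso YE /hvanishes_iso
  ZE]]]].
  rewrite !group_prime_hvanishes XE YE ZE; split.
  + exact: hvanishes_cone.
  + exact: hvanishes_cone_source.
  + exact: hvanishes_cone_target.
- move=> X Y i r ri; rewrite !group_prime_hvanishes;
  exact: hvanishes_retract ri.
- move=> X Y Z /hvanishes_iso ZE; rewrite !group_prime_hvanishes ZE.
  exact: hvanishes_tensor.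
- exists (exist _ _ unitc); rewrite group_prime_hvanishes.
  exact: not_hvanishes_unit.
- move=> X Y Z /hvanishes_iso ZE; rewrite !group_prime_hvanishes ZE.
  exact: hvanishes_tensor_prime.
Qed.

End GroupPrime.

(** * Profinite groups *)

Lemma compact_directed (T : topologicalType) (I : Type) (i0 : I)
    (A : I -> set T) :
    compact [set: T] -> (forall i, closed (A i)) -> (forall i, A i !=set0) ->
    (forall i j, exists l, A l `<=` A i `&` A j) ->
  exists p, forall i, A i p.
Proof.
move=> cT clA neA dirA.
pose F := filter_from [set: I] A.
have FF : ProperFilter F.
  apply: filter_from_proper => [|i _]; last exact: neA.
  apply: filter_from_filter; first by exists i0.
  by move=> i j _ _; have [l lij] := dirA i j; exists l.
have [p [_ clp]] := cT F FF filterT.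
exists p => i; apply: clA => B pB; apply: clp pB.
by exists i.
Qed.

(** In a compact Hausdorff space the quasi-component [Q] of [x], the intersection of the clopen sets
    containing [x], is connected; total disconnectedness then reduces it to a point. *)
Lemma compact_hausdorff_zero_dimensional (T : topologicalType) :
    compact [set: T] -> hausdorff_space T -> totally_disconnected [set: T] ->
  zero_dimensional T.
Proof.
move=> cT hT tdT x y xy; apply: contrapT => nsep.
pose J := {C : set T | clopen C /\ C x}.
pose Q : set T := \bigcap_(i in [set: J]) sval i.
have clI (i : J) : clopen (sval i) by have [] := proj2_sig i.
have Qx : Q x by move=> i _; have [] := proj2_sig i.
have iT : J by exists setT; split=> //; exact: clopenT.
have Qy : Q y.
  move=> [C [clC Cx]] _ /=; apply: contrapT => nCy; apply: nsep.
  by exists C; split.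
have clQ : closed Q by apply: closed_bigI => i _; exact: (clI i).2.
have nbQ (O : set T) : open O -> Q `<=` O -> exists i : J, sval i `<=` O.
  move=> oO QO; apply: contrapT => nO.
  have [|||p pP] := @compact_directed T J iT (fun i => sval i `&` ~` O) cT.
  - by move=> i; apply: closedI; [exact: (clI i).2|exact: open_closedC].
  - move=> i; apply: contrapT => /set0P/negP/negPn/eqP iO; apply: nO.
    by exists i => z iz; apply: contrapT => nOz; rewrite -[False]/(set0 z) -iO.
  - move=> i j; have ijP : clopen (sval i `&` sval j) /\ (sval i `&` sval j) x.
      split; first by apply: clopenI; exact: clI.
      by split; [have [] := proj2_sig i|have [] := proj2_sig j].
    by exists (exist (fun C => clopen C /\ C x) _ ijP) => z [[zi zj] zO].
  have [_] := pP iT; apply; apply: QO => i _; exact: (pP i).1.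
(* A clopen piece [B] of [Q] and its complement in [Q] are disjoint closed sets, separated by
   normality by open sets [V] and [W]. Some clopen set containing [x] lies in their union, and
   cutting it down to the side of [x] puts all of [Q] on that side. *)
have conQ : connected Q.
  move=> B [b Bb] [O oO BO] [F cF BF].
  have clB : closed B by rewrite BF; exact: closedI.
  have clB' : closed (Q `\` B).
    have -> : Q `\` B = Q `&` ~` O.
      apply/seteqP; split=> z [Qz nz]; split=> //.
        by move=> Oz; apply: nz; rewrite BO.
      by rewrite BO => -[].
    by apply: closedI => //; exact: open_closedC.
  have BB' : set_nbhs B (~` (Q `\` B)).
    apply/set_nbhsP; exists (~` (Q `\` B)); split=> //;
      first exact: closed_openC.
    by move=> z Bz [].
  have [D /set_nbhsP[V [oV BV VD]] DB'] := compact_normal hT cT clB BB'.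
  pose W := ~` closure D.
  have oW : open W by apply: closed_openC; exact: closed_closure.
  have VW z : V z -> ~ W z by move=> Vz; apply; apply: subset_closure;
    exact: VD.
  have [||i iVW] := nbQ (V `|` W).
  - exact: openU.
  - move=> z Qz; have [Bz|nBz] := pselect (B z); first by left; exact: BV.
    by right=> /DB'; apply.
  have part (P R : set T) : open P -> open R -> (forall z, P z -> ~ R z) ->
      sval i `<=` P `|` R -> P x -> Q `<=` P.
    move=> oP oR PR iPR Px.
    have iP : clopen (sval i `&` P) /\ (sval i `&` P) x.
      split; last by split=> //; exact: Qx.
      split; first by apply: openI => //; exact: (clI i).1.
      have -> : sval i `&` P = sval i `&` ~` R.
        apply/seteqP; split=> z [iz zP]; split=> //; first exact: PR.
        by have [] := iPR z iz.
      by apply: closedI; [exact: (clI i).2|exact: open_closedC].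
    by move=> z /(_ (exist (fun C => clopen C /\ C x) _ iP) I)[].
  have [Vx|nVx] := pselect (V x).
    have QV := part V W oV oW VW iVW Vx.
    apply/seteqP; split=> [z|z Qz]; first by rewrite BO => -[].
    apply: contrapT => nBz; apply: (VW z (QV z Qz)).
    by move=> /DB'; apply.
  have Wx : W x by have [] := iVW x (Qx i I).
  have QW : Q `<=` W.
    apply: (part W V) => //; first by move=> z Wz Vz; exact: VW Vz Wz.
    by rewrite setUC.
  case: (VW b (BV b Bb)); apply: QW.
  by move: Bb; rewrite BO => -[].
have : connected_component [set: T] x y by exists Q.
by rewrite tdT// => yx; move: xy; rewrite yx eqxx.
Qed.

Section ProfiniteNeighbourhoods.
Variable G : topologicalGroupType.

Lemma translate_continuous (g h : G) : continuous (fun x : G => g * x * h)%g.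
Proof.
move=> x; apply: (@continuous_comp _ _ _ (fun x => (g * x, h)%g)
  (fun p : G * G => p.1 * p.2)%g); last exact: mulg_continuous.
apply: cvg_pair; last exact: cvg_cst.
apply: (@continuous_comp _ _ _ (fun x : G => (g, x))
  (fun p : G * G => p.1 * p.2)%g); last exact: mulg_continuous.
by apply: cvg_pair; [exact: cvg_cst|exact: cvg_id].
Qed.

Lemma mulg3_continuous :
  continuous (fun p : G * (G * G) => (p.2.1 * p.1 * p.2.2)%g).
Proof.
move=> [x [g h]]; apply: (@continuous_comp _ _ _
  (fun p : G * (G * G) => (p.2.1 * p.1, p.2.2)%g)
  (fun p : G * G => p.1 * p.2)%g); last exact: mulg_continuous.
apply: cvg_pair.
  apply: (@continuous_comp _ _ _
    (fun p : G * (G * G) => (p.2.1, p.1))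
    (fun p : G * G => p.1 * p.2)%g); last exact: mulg_continuous.
  apply: cvg_pair; last exact: cvg_fst.
  apply: (@continuous_comp _ _ _ snd fst); [exact: cvg_snd|exact: cvg_fst].
apply: (@continuous_comp _ _ _ snd snd); [exact: cvg_snd|exact: cvg_snd].
Qed.

Hypothesis Gprof : profinite G.

(** [N] is the class of 1 in the syntactic congruence of a clopen set [A] inside [B]: this makes it
    normal, and [g = h = 1] puts it inside [A]. *)
Lemma open_normal_basis (B : set G) : nbhs 1%g B ->
  exists N : set G, [/\ open N, is_normal N & N `<=` B].
Proof.
move=> nB; have [cG hG tdG] := Gprof.
have zdG := compact_hausdorff_zero_dimensional cG hG tdG.
have [A [A1 [oA cA]] AB] := zero_dimensional_cvg hG zdG cG nB.
pose N : set G := [set x | forall g h, A (g * x * h)%g <-> A (g * h)%g].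
exists N; split.
- rewrite openE => x Nx.
  pose m3 (p : G * (G * G)) := (p.2.1 * p.1 * p.2.2)%g.
  pose m2 (p : G * (G * G)) := (p.2.1 * p.2.2)%g.
  have m2c : continuous m2.
    move=> p; apply: (@continuous_comp _ _ _ snd
      (fun p : G * G => p.1 * p.2)%g); [exact: cvg_snd|exact: mulg_continuous].
  have cGG : compact [set: G * G].
    by rewrite -setXTT; exact: compact_setX.
  (* For each pair [(g, h)] the condition is open because [A] is clopen; compactness of [G * G]
     gives one neighbourhood of [x] valid for all pairs. *)
  have := (iffLR (compact_near_coveringP _) cGG) G (nbhs x)
    (fun x' p => A (m3 (x', p)) <-> A (m2 (x', p))) _.
  have cov : forall p : G * G, [set: G * G] p ->
    \forall p' \near p & x' \near x, A (m3 (x', p')) <-> A (m2 (x', p')).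
    move=> p _.
    pose W := [set q : G * (G * G) | A (m3 q) <-> A (m2 q)].
    have oW : open W.
      have -> : W = ((m3 @^-1` A) `&` (m2 @^-1` A)) `|`
                    ((m3 @^-1` ~` A) `&` (m2 @^-1` ~` A)).
        apply/seteqP; split=> q; rewrite /W /=.
          by move=> Wq; have [a|a] := pselect (A (m3 q)); [left|right];
            split=> //;
            rewrite -?Wq// => /Wq.
        by case=> -[].
      have oAc : open (~` A) by exact: closed_openC.
      apply: openU; apply: openI; apply: open_comp => //;
        by move=> q _; first [exact: mulg3_continuous|exact: m2c].
    have : nbhs (x, p) W by apply: open_nbhs_nbhs; split=> //; apply: Nx.
    move=> [[P R] [/= Px Rp] PRW]; exists (R, P) => //=.
    by move=> [p' x'] [/= Rp' Px']; exact: (PRW (x', p')).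
  move=> /(_ _ cov) nearW; apply: filterS nearW => x' xP g h.
  exact: (xP (g, h) I).
- split; first split=> [g h|x y Nx Ny g h|x Nx g h].
  + by rewrite mulg1.
  + by rewrite mulgA -(mulgA _ y) Nx mulgA Ny.
  + by rewrite -(Nx (g * x^-1)%g h) mulgKV.
  + move=> x y Nx g h.
    by rewrite /conjg !mulgA -(mulgA _ y) Nx mulgA mulgKV.
- move=> x Nx; apply: AB.
  by have := Nx 1%g 1%g; rewrite mulg1 mul1g mulg1 => ->.
Qed.

End ProfiniteNeighbourhoods.

Section OpenEpimorphisms.
Variable G : topologicalGroupType.

Lemma translate_open (g : G) (A : set G) :
  open A -> open [set x | A (g * x)%g].
Proof.
move=> oA; have -> : [set x | A (g * x)%g] = (fun x => g * x * 1)%g @^-1` A.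
  by apply/seteqP; split=> x; rewrite /= mulg1.
by apply: open_comp => // x _; exact: translate_continuous.
Qed.

(** Groups of [U] carry no topology, so an open kernel stands for continuity into the discrete group
    [Q]. *)
Lemma epi_preimage_open (Q : groupType) (phi : epi G Q) (S : set Q) :
  open (epi_ker phi) -> open [set x | S (phi x)].
Proof.
move=> ok; rewrite openE => x Sx.
have ox := translate_open x^-1%g ok.
have : nbhs x [set y | epi_ker phi (x^-1 * y)%g].
  by apply: open_nbhs_nbhs; split=> //=; rewrite /epi_ker /= mulVg epi1.
apply: filterS => y /=; rewrite /epi_ker /= epiM epiV => e.
have -> // : phi y = phi x.
by apply: (mulgI (phi x)^-1%g); rewrite e mulVg.
Qed.

Lemma epi_preimage_closed (Q : groupType) (phi : epi G Q) (S : set Q) :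
  open (epi_ker phi) -> closed [set x | S (phi x)].
Proof. by move=> ok; rewrite -openC; exact: (epi_preimage_open (~` S)). Qed.

Lemma open_epi_eq (s : seq G) (Q : groupType) (phi psi : epi G Q) :
    dense (smallest (@is_subgroup G) [set` s]) ->
    open (epi_ker phi) -> open (epi_ker psi) ->
    (forall x, x \in s -> phi x = psi x) ->
  forall x, phi x = psi x.
Proof.
move=> ds ophi opsi es x.
have [||y [[yphi ypsi] ys]] := ds ([set y | phi y = phi x] `&` [set y
  | psi y = psi x]).
- by exists x.
- apply: openI.
    exact: (epi_preimage_open [set c | c = phi x]).
  exact: (epi_preimage_open [set c | c = psi x]).
rewrite -yphi -ypsi; apply: (ys [set z | phi z = psi z]); split=> //.
split=> [|u v /= e e'|u /= e]; first by rewrite /= !epi1.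
  by rewrite !epiM e e'.
by rewrite !epiV e.
Qed.

End OpenEpimorphisms.

Section ProfiniteGroups.
Variables (U : finGrp -> Prop) (G : topologicalGroupType).
Hypothesis GU : in_profinite_extension U G.

Lemma uq_basis (B : set G) : nbhs 1%g B ->
  exists q : uquotient U G, epi_ker (uq_proj q) `<=` B.
Proof.
have [Gprof _ _] := GU => /(open_normal_basis Gprof)[N [oN nN NB]].
have [q qN] := open_normal_uquotient GU oN nN.
by exists q; exact: subset_trans NB.
Qed.

Lemma uq_separates (x y : G) :
  (forall q : uquotient U G, uq_proj q x = uq_proj q y) -> x = y.
Proof.
move=> xy; have [[_ hG _] _ _] := GU.
suff: (1 = x^-1 * y)%g by move=> /(congr1 (mulg x)); rewrite mulg1 mulKVg.
apply: hG => A B A1 Bxy; exists (x^-1 * y)%g; split; last exact: nbhs_singleton.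
have [q qA] := uq_basis A1; apply: qA.
by rewrite /epi_ker /= epiM epiV xy mulVg.
Qed.

(* The family is reindexed by kernels: [uquotient U G] lives in too large a
   universe to index a filter base. *)
Lemma compact_uquotients (T : topologicalType) (A : uquotient U G -> set T) :
    compact [set: T] -> (forall q, closed (A q)) -> (forall q, A q !=set0) ->
    (forall q' q (r : hom (uq_ob q') (uq_ob q)), uq_over r -> A q' `<=` A q) ->
  exists p, forall q, A q p.
Proof.
move=> cT clA neA monA; have [q0] := uquotient_inhabited GU.
have [||||p pA] := @compact_directed T {N : set G | NN U N} (NN_of q0)
    (fun N => A (uq_of N)) => //.
  move=> N1 N2.
  have [q [r1 [r2 [r1q r2q]]]] := uq_directed GU (uq_of N1) (uq_of N2).
  have [[r rq] _] := uq_of_NN q.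
  exists (NN_of q) => x /(monA _ _ _ rq) Aq.
  by split; [exact: monA r1q _ Aq|exact: monA r2q _ Aq].
exists p => q; have [[r rq] _] := uq_of_NN q.
exact: monA rq _ (pA _).
Qed.

(** Composing a finite quotient with the powers of [e] yields maps determined by their values on
    finitely many topological generators, so two different powers give the same map. *)
Lemma surjective_endomorphism_injective (e : cepi G G) : injective e.
Proof.
have [_ [s ds] _] := GU.
pose eps i : cepi G G := iter i (cepi_comp e) (cepi_id G).
have epsE i x : eps i x = iter i e x by elim: i => //= i <-.
suff ker1 x : e x = 1%g -> x = 1%g.
  move=> x y exy; apply: (mulIg y^-1%g); rewrite mulgV.
  by apply: ker1; rewrite epiM epiV exy mulgV.
move=> ex1; apply: uq_separates => q; rewrite epi1.
pose phi i : epi G (sval (uq_ob q)) := epi_comp (uq_proj q) (eps i).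
have ophi i : open (epi_ker (phi i)).
  rewrite (_ : epi_ker (phi i) = eps i @^-1` epi_ker (uq_proj q)) //.
  by apply: open_comp (uq_open q) => y _; exact: cepi_continuous.
pose t i : (size s).-tuple (sval (uq_ob q)) :=
  [tuple phi i (tnth (in_tuple s) l) | l < size s].
have [i [d [d0 tid]]] : exists i d, (0 < d)%N /\ t i = t (d + i)%N.
  apply: contrapT => ninj.
  pose n := #|{: (size s).-tuple (sval (uq_ob q))}|.
  suff /leq_card : injective (fun l : 'I_n.+1 => t l) by rewrite card_ord ltnn.
  move=> a b; wlog ab : a b / (a <= b)%N.
    by move=> W; have [/W //|/ltnW/W ba tab] := leqP a b; rewrite ba.
  move=> tab; apply: val_inj; apply: contrapT => nab; apply: ninj.
  exists a, (b - a)%N; rewrite subnK//; split=> //.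
  by rewrite subn_gt0 ltn_neqAle ab andbT; apply/eqP.
have phiE : forall y, phi i y = phi (d + i)%N y.
  apply: (open_epi_eq ds) => // y /(nthP 1%g)[l ls <-].
  have := congr1 (fun u => tnth u (Ordinal ls)) tid.
  by rewrite !tnth_mktuple (tnth_nth 1%g).
(* At a preimage [y] of [x] under the power [i] of [e], the two equal maps compare the images of [x]
   and of the power [d] of [e] at [x], which is 1 since [d > 0]. *)
have [y yx] := epi_surj (eps i) x.
have := phiE y; rewrite /= !epsE iterD -!epsE yx => ->.
rewrite epsE; case: d d0 {tid phiE} => // d _.
by rewrite iterSr ex1 -epsE epi1 epi1.
Qed.

End ProfiniteGroups.

(** * Continuous surjections from a compatible choice of finite quotients *)

Section SameQuotients.
Variables (U : finGrp -> Prop) (G H : topologicalGroupType).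
Hypothesis GU : in_profinite_extension U G.
Hypothesis HU : in_profinite_extension U H.
Hypothesis quotients : forall q : uquotient U H,
  exists phi : epi G (sval (uq_ob q)), open (epi_ker phi).

(** Arbitrary functions are allowed, so that the ambient space is a product of copies of [H],
    compact by Tychonoff. A function in every [lifts q] will turn out to be a continuous
    epimorphism. *)
Let lifts (q : uquotient U H) : set {ptws G -> H} :=
  [set f | exists phi : epi G (sval (uq_ob q)),
     open (epi_ker phi) /\ forall x, uq_proj q (f x) = phi x].

Lemma near_lift (q : uquotient U H) (f : {ptws G -> H}) (s : seq G) :
  \forall f' \near f, forall x, x \in s -> uq_proj q (f' x) = uq_proj q (f x).
Proof.
have nF : Filter (nbhs f) by exact: nbhs_filter.
elim: s => [|x s IH]; first by apply: (@nearW _ (nbhs f)) => f' y;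
  rewrite in_nil.
have nx : \forall f' \near f, uq_proj q (f' x) = uq_proj q (f x).
  have oc := epi_preimage_open [set c | c = uq_proj q (f x)] (uq_open q).
  have nO : nbhs (f x) [set y | uq_proj q y = uq_proj q (f x)].
    by apply: open_nbhs_nbhs.
  exact: (@proj_continuous G (fun=> H) x f _ nO).
apply: filterS2 IH nx => f' fs fx y.
by rewrite inE => /predU1P[->|/fs].
Qed.

(** This is where finite generation of [G] enters: near [f] there are elements of [lifts q] agreeing
    with [f] modulo [q] on the generators and on one further point. Their epimorphisms agree on the
    generators, hence coincide. *)
Lemma lifts_closed q : closed (lifts q).
Proof.
have [_ [s ds] _] := GU.
move=> f clf.
have [f1 [[phi [ophi f1E]] f1s]] := clf _ (near_lift q f s).
exists phi; split=> // x.
have [f2 [[psi [opsi f2E]] f2s]] := clf _ (near_lift q f (x :: s)).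
rewrite -f2s ?mem_head// f2E; apply: (open_epi_eq ds) => // y ys.
by rewrite -f1E -f2E f1s// f2s// inE ys orbT.
Qed.

Lemma lifts_over q' q (r : hom (uq_ob q') (uq_ob q)) :
  uq_over r -> lifts q' `<=` lifts q.
Proof.
move=> rq f [phi [ophi fE]].
exists (epi_comp r phi); split; last by move=> x; rewrite -rq fE.
exact: (epi_preimage_open [set c | r c = 1%g]).
Qed.

Lemma cepi_exists : inhabited (cepi G H).
Proof.
have [[cG _ _] _ _] := GU; have [[cH _ _] _ _] := HU.
have cP : compact [set: {ptws G -> H}].
  have := @tychonoff G (fun=> H) (fun=> setT) (fun=> cH).
  by congr compact; apply/seteqP.
have [|f fP] := compact_uquotients HU cP lifts_closed _ lifts_over.
  move=> q; have [phi ophi] := quotients q.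
  (* A set-theoretic section of the projection suffices here. *)
  have [s sP] := choice (epi_surj (uq_proj q)).
  by exists (fun x => s (phi x)), phi.
pose phi q := projT1 (cid (fP q)).
have ophi q : open (epi_ker (phi q)) := (projT2 (cid (fP q))).1.
have phiE q : forall x, uq_proj q (f x) = phi q x := (projT2 (cid (fP q))).2.
have fM x y : f (x * y)%g = (f x * f y)%g.
  by apply: (uq_separates HU) => q; rewrite epiM !phiE epiM.
have f_cont : continuous (f : G -> H).
  move=> x B Bfx.
  have B1 : nbhs 1%g [set z | B (f x * z)%g].
    have B1' : nbhs (f x * 1 * 1)%g B by rewrite !mulg1.
    have : nbhs 1%g [set z | B (f x * z * 1)%g].
      exact: (@translate_continuous H (f x) 1%g 1%g B B1').
    by apply: filterS => z; rewrite /= mulg1.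
  have [q qB] := uq_basis HU B1.
  have : nbhs x [set y | phi q y = phi q x].
    apply: open_nbhs_nbhs; split=> //.
    exact: (epi_preimage_open [set c | c = phi q x]).
  apply: filterS => y /= xy.
  have /qB /= : epi_ker (uq_proj q) ((f x)^-1 * f y)%g.
    by rewrite /epi_ker /= epiM epiV !phiE xy mulVg.
  by rewrite mulKVg.
(* The fibre over [y] is a directed intersection of nonempty closed sets, one for each quotient of
   [H]. *)
have f_surj y : exists x, f x = y.
  have [|||x xP] := @compact_uquotients _ _ HU G
    (fun q => [set x | phi q x = uq_proj q y]) cG.
  - by move=> q; exact: (@epi_preimage_closed G _ (phi q) [set c
    | c = uq_proj q y] (ophi q)).
  - by move=> q; have [x <-] := epi_surj (phi q) (uq_proj q y); exists x.
  - by move=> q' q r rq x /= xq; rewrite -phiE -(rq (f x)) -(rq y) phiE xq.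
  by exists x; apply: (uq_separates HU) => q; rewrite phiE; exact: xP.
by constructor; exists (Epi fM f_surj).
Qed.

End SameQuotients.

Lemma iso_of_same_quotients (U : finGrp -> Prop) (G H : profinite_extension U) :
    (forall Q : fullsub U,
      (exists phi : epi (sval G) (sval Q), open (epi_ker phi)) <->
      (exists phi : epi (sval H) (sval Q), open (epi_ker phi))) ->
  iso G H.
Proof.
case: G H => [G GU] [H HU] /= GH.
have [|f] := cepi_exists GU HU.
  by move=> q; apply/GH; exists (uq_proj q); exact: uq_open.
have [|g] := cepi_exists HU GU.
  by move=> q; apply/GH; exists (uq_proj q); exact: uq_open.
have f_inj : injective f.
  have gf_inj := surjective_endomorphism_injective GU (e := cepi_comp g f).
  by move=> x y fxy; apply: gf_inj; rewrite /= fxy.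
(* [g] served only to make [f] injective and need not be its inverse; the inverse [h] is continuous
   because [f] is a closed map from a compact to a Hausdorff space. *)
have [h fh] := choice (epi_surj f).
have hf x : h (f x) = x by apply: f_inj; rewrite fh.
have hM x y : h (x * y)%g = (h x * h y)%g.
  by apply: f_inj; rewrite epiM !fh.
have h_surj x : exists y, h y = x by exists (f x).
have h_cont : continuous (h : H -> G).
  apply/continuousP => A oA.
  have [[cG _ _] _ _] := GU; have [[_ hH _] _ _] := HU.
  have -> : h @^-1` A = ~` (f @` (~` A)).
    apply/seteqP; split=> y /=.
      by move=> Ahy [x nAx xy]; apply: nAx; rewrite -(hf x) xy.
    by move=> ny; apply: contrapT => nA; apply: ny; exists (h y).
  apply: closed_openC; apply: compact_closed => //.
  apply: continuous_compact.
    by apply: continuous_subspaceT => x; exact: cepi_continuous.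
  by apply: subclosed_compact cG _ => //; exact: open_closedC.
exists f, (@Cepi H G (Epi hM h_surj) h_cont); split; exists 1%g => x.
  by rewrite conjg1 /= hf.
by rewrite conjg1 /= fh.
Qed.

(** * Representable presheaves in the derived category *)

Section FreeComplex.
Variables (k : fieldType) (U : finGrp -> Prop) (c : fullsub U).
Let C := fullsub U.

(* Cells [j] of dimension [deg j], each generating a copy of the representable
   presheaf k[hom (-, c)]; [face j] is the differential of the cell [j]. *)
Variables (J : Set) (deg : J -> int) (face : J -> option J).
Hypothesis face_deg : forall j j', face j = Some j' -> deg j = deg j' + 1.
Hypothesis face_face : forall j j', face j = Some j' -> face j' = None.

(* [hom a c] is spelled out: as a morphism type of an arbitrary category it
   would live in too large a universe to generate a module. *)
Record cell n (a : C) := Cell {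
  cell_index : J;
  cell_hom : epi (sval a) (sval c);
  cell_deg : deg cell_index = n }.

(** Morphisms of [U] are conjugacy classes, so conjugate homomorphisms must give the same
    generator. *)
Inductive cell_rel n a : seq (k * cell n a) -> Prop :=
| cell_eqh j (u u' : hom a c) (e : deg j = n) : u =h u' ->
    cell_rel (eq_relator k (Cell u e) (Cell u' e)).

Definition free_mod n a : lmodType k := pres (@cell_rel n a).

Definition fgen n a j (u : hom a c) (e : deg j = n) : free_mod n a :=
  pgen (@cell_rel n a) (Cell u e).

Lemma fgen_eqh n a j (u u' : hom a c) (e : deg j = n) :
  u =h u' -> fgen u e = fgen u' e.
Proof.
by move=> uu'; apply/(fsum_eqr (pgen _)); apply: pgen_kills; exact: cell_eqh.
Qed.

Lemma free_ext n a (W : lmodType k) (f g : {linear free_mod n a -> W}) :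
  (forall j u (e : deg j = n), f (fgen u e) = g (fgen u e)) -> f =1 g.
Proof. by move=> fg; apply: pres_ext => -[j u e]; exact: fg. Qed.

Section Lift.
Variables (n : int) (a : C) (W : lmodType k).
Variable b : forall j, epi (sval a) (sval c) -> deg j = n -> W.
Hypothesis b_eqh : forall j (u u' : hom a c) (e : deg j = n),
  u =h u' -> b u e = b u' e.

Lemma free_lift_kills :
  kills (@cell_rel n a) (fun g => b (cell_hom g) (cell_deg g)).
Proof. by move=> _ [j u u' e uu']; apply/fsum_eqr; exact: b_eqh. Qed.

Definition free_lift : {linear free_mod n a -> W} := plift free_lift_kills.

Lemma free_liftE j u (e : deg j = n) : free_lift (fgen u e) = b u e.
Proof. exact: plift_gen. Qed.

End Lift.

Lemma free_pmap_eqh n a b (f : hom a b) j (u u' : hom b c) (e : deg j = n) :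
  u =h u' -> fgen (u \oh f) e = fgen (u' \oh f) e.
Proof. by move=> uu'; apply/fgen_eqh/comph_eq => //; exact: eqh_refl. Qed.

Definition free_pmap n a b (f : hom a b) : {linear free_mod n b ->
  free_mod n a} :=
  free_lift (@free_pmap_eqh n a b f).

Lemma free_pmapE n a b (f : hom a b) j u (e : deg j = n) :
  free_pmap n f (fgen u e) = fgen (u \oh f) e.
Proof. exact: free_liftE. Qed.

Lemma free_pmap_eq n a b (f g : hom a b) :
  f =h g -> free_pmap n f =1 free_pmap n g.
Proof.
move=> fg; apply: free_ext => j u e; rewrite !free_pmapE; apply: fgen_eqh.
by apply: comph_eq => //; exact: eqh_refl.
Qed.

Lemma free_pmap_id n a : free_pmap n (idh a) =1 id.
Proof.
apply: (@free_ext _ _ _ _ idfun) => j u e; rewrite free_pmapE.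
by apply: fgen_eqh; exact: comph_idr.
Qed.

Lemma free_pmap_comp n x y z (g : hom y z) (f : hom x y) :
  free_pmap n (g \oh f) =1 free_pmap n f \o free_pmap n g.
Proof.
apply: (@free_ext _ _ _ _ (free_pmap n f \o free_pmap n g)%R) => j u e.
rewrite -[RHS]/(free_pmap n f (free_pmap n g _)) !free_pmapE.
by apply: fgen_eqh; exact: comphA.
Qed.

Definition free_psh n : presheaf k C :=
  @Presheaf k C (free_mod n) (@free_pmap n) (@free_pmap_eq n)
    (@free_pmap_id n) (@free_pmap_comp n).

Definition face_gen m a j (u : hom a c) : free_mod m a :=
  match face j with
  | Some j' => match pselect (deg j' = m) with
               | left e => fgen u e
               | right _ => 0
               end
  | None => 0
  end.

Lemma face_gen_eqh n m a j (u u' : hom a c) (e : deg j = n) :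
  u =h u' -> face_gen m j u = face_gen m j u'.
Proof.
move=> uu'; rewrite /face_gen; case: (face j) => // j'.
by case: pselect => // e'; exact: fgen_eqh.
Qed.

Definition free_d n m a : {linear free_psh n a -> free_psh m a} :=
  free_lift (@face_gen_eqh n m a).

Lemma free_dE n m a j u (e : deg j = n) :
  free_d n m a (fgen u e) = face_gen m j u.
Proof. exact: free_liftE. Qed.

Lemma free_d_nat n m a b (f : hom a b) t :
  free_d n m a (pmap (free_psh n) f t) = pmap (free_psh m) f (free_d n m b t).
Proof.
move: t; apply: (@free_ext _ _ _ (free_d n m a \o free_pmap n f)%R
  (free_pmap m f \o free_d n m b)%R) => j u e.
rewrite -[LHS]/(free_d n m a (free_pmap n f _)).
rewrite -[RHS]/(free_pmap m f (free_d n m b _)).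
rewrite free_pmapE !free_dE /face_gen; case: (face j) => [j'|]; last first.
  by rewrite linear0.
by case: pselect => e'; rewrite ?linear0// free_pmapE.
Qed.

Definition free_cd n m : psh_map (free_psh n) (free_psh m) :=
  @PshMap k C (free_psh n) (free_psh m) (free_d n m) (@free_d_nat n m).

Lemma free_cd_shape n m a t : n <> m + 1 -> free_cd n m a t = 0.
Proof.
move=> nm; move: t; apply: (@free_ext _ _ _ (free_d n m a) \0) => j u e.
rewrite free_dE /face_gen; case E : (face j) => [j'|//].
by case: pselect => // e'; case: nm; rewrite -e (face_deg E) e'.
Qed.

Lemma free_cd_cd n m l a t : free_cd m l a (free_cd n m a t) = 0.
Proof.
move: t; apply: (@free_ext _ _ _ (free_d m l a \o free_d n m a)%R \0).
move=> j u e; rewrite -[LHS]/(free_d m l a (free_d n m a _)) free_dE.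
rewrite /face_gen; case E : (face j) => [j'|]; last by rewrite linear0.
case: pselect => [e'|_]; last by rewrite linear0.
by rewrite free_dE /face_gen (face_face E).
Qed.

Definition free_complex : complex k C := Complex free_cd_shape free_cd_cd.

Section FreeMap.
Variables (Y : complex k C) (y : forall j, Y (deg j) c).
Hypothesis y_face : forall j m, cd Y (deg j) m c (y j) =
  if face j is Some j' then
    if pselect (deg j' = m) is left e then ecast m (Y m c) e (y j') else 0
  else 0.

Definition value_at n a j (u : hom a c) (e : deg j = n) : Y n a :=
  pmap (Y n) u (ecast n (Y n c) e (y j)).

Lemma value_at_eqh n a j (u u' : hom a c) (e : deg j = n) :
  u =h u' -> value_at u e = value_at u' e.
Proof. by move=> uu'; exact: pmap_eq. Qed.

Definition free_fun n a : {linear free_complex n a -> Y n a} :=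
  free_lift (@value_at_eqh n a).

Lemma free_funE n a j u (e : deg j = n) : free_fun n a (fgen u e) = value_at u
  e.
Proof. exact: free_liftE. Qed.

Lemma free_fun_nat n a b (f : hom a b) t :
  free_fun n a (pmap (free_complex n) f t) = pmap (Y n) f (free_fun n b t).
Proof.
move: t; apply: (@free_ext _ _ _ (free_fun n a \o free_pmap n f)%R
  (pmap (Y n) f \o free_fun n b)%R) => j u e.
rewrite -[LHS]/(free_fun n a (free_pmap n f _)).
rewrite -[RHS]/(pmap (Y n) f (free_fun n b _)) free_pmapE !free_funE.
by rewrite /value_at pmap_comp.
Qed.

Definition free_fun_psh n : psh_map (free_complex n) (Y n) :=
  @PshMap k C (free_complex n) (Y n) (free_fun n) (@free_fun_nat n).

Lemma free_fun_cd n m a t :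
  free_fun_psh m a (cd free_complex n m a t)
  = cd Y n m a (free_fun_psh n a t).
Proof.
move: t; apply: (@free_ext _ _ _ (free_fun m a \o free_d n m a)%R
  (cd Y n m a \o free_fun n a)%R) => j u e.
rewrite -[LHS]/(free_fun m a (free_d n m a _)).
rewrite -[RHS]/(cd Y n m a (free_fun n a _)) free_dE free_funE.
subst n; rewrite /value_at pm_nat y_face /face_gen.
case: (face j) => [j'|]; last by rewrite !linear0.
case: pselect => [e'|_]; last by rewrite !linear0.
exact: free_funE.
Qed.

Definition free_map : cmap free_complex Y := Cmap free_fun_cd.

Lemma free_mapE j a (u : hom a c) :
  free_map (deg j) a (fgen u erefl) = pmap (Y (deg j)) u (y j).
Proof. exact: free_funE. Qed.

End FreeMap.

Lemma free_cmap_ext (Y : complex k C) (f g : cmap free_complex Y) :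
  (forall j, f (deg j) c (fgen (idh c) erefl) = g (deg j) c (fgen (idh c)
    erefl)) ->
  forall n a t, f n a t = g n a t.
Proof.
move=> fg n a; apply: free_ext => j u e; subst n.
have -> : fgen u (erefl (deg j)) = pmap (free_complex (deg j)) u (fgen (idh c)
  erefl).
  rewrite -[RHS]/(free_pmap _ u _) free_pmapE; apply/fgen_eqh/eqh_sym.
  exact: comph_idl.
by rewrite !pm_nat fg.
Qed.

End FreeComplex.

Section DerivedHom.
Variables (k : fieldType) (C : category).
Implicit Types X Y Z : complex k C.

Lemma quasi_iso_zero X :
  (forall n a (x : X n a), (forall j, cd X n j a x = 0) -> boundary x) ->
  quasi_iso (cm_zero X (zero_complex k C)).
Proof.
move=> bX n a.
have h0 (u : homology X n a) : u = 0.
  have [z ->] := hclass_surj u; apply/hclass_eq0; apply: bX; exact: proj2_sig z.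
have h0' (u : homology (zero_complex k C) n a) : u = 0.
  have [z ->] := hclass_surj u; apply/hclass_eq0.
  by rewrite [sval z]thinmx0; exact: boundary0.
by exists (fun=> 0) => u; [rewrite [u]h0|rewrite [u]h0' linear0].
Qed.

(** For acyclic [Y] the zero map to [zero_complex] is a quasi-isomorphism; cancelling it against its
    formal inverse shows that the identity of [Y] is zero. *)
Lemma deq_through_acyclic X Y Z (f : cmap X Y) (g : cmap Y Z) :
  (forall n a (x : Y n a), (forall j, cd Y n j a x = 0) -> boundary x) ->
  deq (dmap (cm_comp g f)) (dzero X Z).
Proof.
move=> /quasi_iso_zero qs.
have idY : deq (dmap (cm_id Y)) (dzero Y Y).
  apply: deq_trans (deq_sym (deq_invl qs)) _; exact: deq_comp0r.
apply: deq_trans (deq_map_comp g f) _.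
apply: deq_trans (deq_comp (deq_refl _) (deq_sym (deq_idl _))) _.
apply: deq_trans (deq_comp (deq_refl _) (deq_comp idY (deq_refl _))) _.
apply: deq_trans (deq_comp (deq_refl _) (deq_comp0l _ _)) _.
exact: deq_comp0r.
Qed.

End DerivedHom.

Section Representable.
Variables (k : fieldType) (U : finGrp -> Prop) (c : fullsub U).
Let C := fullsub U.
Implicit Types X Y Z : complex k (fullsub U).

Definition rep : complex k (fullsub U) :=
  @free_complex k U c unit (fun=> 0) (fun=> None)
    (fun j j' e => ltac:(discriminate e)) (fun j j' e => ltac:(discriminate e)).

Definition rep_gen a (u : hom a c) : rep 0 a :=
  @fgen k U c unit (fun=> 0) 0 a tt u erefl.

Lemma rep_cd n m a t : cd rep n m a t = 0.
Proof.
move: t; apply: (@free_ext _ _ _ _ _ _ _ _ (cd rep n m a) \0) => j u e.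
exact: free_dE.
Qed.

Definition rep_cycle a (u : hom a c) : cycle rep 0 a :=
  exist (fun x : rep 0 a => forall j, cd rep 0 j a x = 0) (rep_gen u)
    (fun j => rep_cd _ _).

Definition rep_map Y (z : cycle Y 0 c) : cmap rep Y :=
  @free_map k U c unit (fun=> 0) (fun=> None) _ _ Y (fun=> sval z)
    (fun _ m => proj2_sig z m).

Lemma rep_mapE Y (z : cycle Y 0 c) :
  rep_map z 0 c (rep_gen (idh c)) = sval z.
Proof. by rewrite [LHS](@free_mapE k U c unit) pmap_id. Qed.

Lemma rep_cmap_ext Y (f g : cmap rep Y) :
  f 0 c (rep_gen (idh c)) = g 0 c (rep_gen (idh c)) ->
  forall n a t, f n a t = g n a t.
Proof. by move=> fg; apply: free_cmap_ext => -[]. Qed.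

(** The disc has one cell in degree 1 whose differential is the cell in degree 0. The degree is
    written [0 + 1] to match the form [n + 1] in [boundary]. *)
Let disc_deg (b : bool) : int := if b then 0 + 1 else 0.
Let disc_face (b : bool) := if b then Some false else None.

Lemma disc_face_deg j j' : disc_face j = Some j' ->
  disc_deg j = disc_deg j' + 1.
Proof. by case: j => // -[<-]. Qed.

Lemma disc_face_face j j' : disc_face j = Some j' -> disc_face j' = None.
Proof. by case: j => // -[<-]. Qed.

Definition disc : complex k (fullsub U) :=
  @free_complex k U c bool disc_deg disc_face disc_face_deg disc_face_face.

Let dgen n a b (u : hom a c) (e : disc_deg b = n) : disc n a :=
  @fgen k U c bool disc_deg n a b u e.

(** The contracting homotopy: the lower cell goes to the upper one, the upper one to 0. *)
Definition disc_contract_fun n a (b : bool) (u : hom a c) : disc n a :=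
  if b then 0
  else if pselect (disc_deg true = n) is left e then dgen u e else 0.

Lemma disc_contract_eqh n m a b (u u' : hom a c) (e : disc_deg b = n) :
  u =h u' -> disc_contract_fun m b u = disc_contract_fun m b u'.
Proof.
move=> uu'; rewrite /disc_contract_fun; case: b e => // e.
by case: pselect => // e'; exact: fgen_eqh.
Qed.

Definition disc_contract n m a : {linear disc n a -> disc m a} :=
  free_lift (@disc_contract_eqh n m a).

Lemma disc_contractE n m a b (u : hom a c) (e : disc_deg b = n) :
  disc_contract n m a (dgen u e) = disc_contract_fun m b u.
Proof. exact: free_liftE. Qed.

Lemma disc_cdE n m a b (u : hom a c) (e : disc_deg b = n) :
  cd disc n m a (dgen u e) =
  if b then if pselect (disc_deg false = m) is left e' then dgen u e' else 0
  else 0.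
Proof. by rewrite [LHS]free_dE /face_gen; case: b e. Qed.

Lemma disc_acyclic n a (x : disc n a) :
  (forall j, cd disc n j a x = 0) -> boundary x.
Proof.
move=> xZ.
suff -> : x = cd disc (n + 1) n a (disc_contract n (n + 1) a x)
            + disc_contract (n - 1) n a (cd disc n (n - 1) a x).
  by rewrite xZ linear0 addr0; exact: cd_boundary.
move: x {xZ}.
pose F : {linear disc n a -> disc n a} :=
  ((cd disc (n + 1) n a \o disc_contract n (n + 1) a)
  \+ (disc_contract (n - 1) n a \o cd disc n (n - 1) a))%R.
apply: (@free_ext _ _ _ _ _ _ _ _ idfun F) => j u e.
rewrite -[LHS]/(dgen u e) -[RHS]/(cd disc (n + 1) n a (disc_contract n (n + 1)
  a (dgen u e))
   + disc_contract (n - 1) n a (cd disc n (n - 1) a (dgen u e))).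
rewrite disc_cdE disc_contractE /disc_contract_fun.
case: j e => e; last first.
  rewrite linear0 addr0; case: pselect => [e'|[]]; last by rewrite -e.
  rewrite disc_cdE; case: pselect => // e''.
  by rewrite (Prop_irrelevance e'' e).
rewrite linear0 add0r; case: pselect => [e'|[]]; last by rewrite -e.
rewrite disc_contractE /disc_contract_fun; case: pselect => // e''.
by rewrite (Prop_irrelevance e'' e).
Qed.

Section DiscMap.
Variables (Y : complex k (fullsub U)) (v : Y (0 + 1) c).

Let value b : Y (disc_deg b) c :=
  if b return Y (disc_deg b) c then v else cd Y (0 + 1) 0 c v.

Lemma disc_value_face b m : cd Y (disc_deg b) m c (value b) =
  if disc_face b is Some b' then
    if pselect (disc_deg b' = m) is left e then ecast m (Y m c) e (value b')
    else 0
  else 0.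
Proof.
case: b => /=; last by rewrite cd_cd.
case: pselect => [e|ne]; first by subst m.
by rewrite cd_shape// => /addIr.
Qed.

Definition disc_map : cmap disc Y := @free_map k U c bool _ _ _ _ Y value
  disc_value_face.

Lemma disc_mapE : disc_map 0 c (dgen (b := false) (idh c) erefl) = cd Y (0 +
  1) 0 c v.
Proof.
apply: etrans (@free_mapE _ _ _ _ _ _ _ _ Y _ disc_value_face false c (idh c))
  _.
exact: pmap_id.
Qed.

End DiscMap.

(** A bounding element [v] extends the map over the disc, which is acyclic. *)
Lemma rep_map_boundary Y (v : Y (0 + 1) c) (z : cycle Y 0 c) :
  sval z = cd Y (0 + 1) 0 c v -> deq (dmap (rep_map z)) (dzero rep Y).
Proof.
move=> zE.
pose g := dgen (b := false) (idh c) erefl.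
have gZ j : cd disc 0 j c g = 0 by exact: (free_dE _ _ _).
pose i := rep_map (exist (fun x : disc 0 c => forall j,
  cd disc 0 j c x = 0) g gZ).
apply: deq_trans (deq_through_acyclic i (disc_map v) disc_acyclic).
apply/deq_map/rep_cmap_ext; rewrite rep_mapE.
rewrite -[RHS]/(disc_map v 0 c (i 0 c _)) rep_mapE zE.
exact/esym/disc_mapE.
Qed.

Lemma rep_map_homologous Y (z z' : cycle Y 0 c) :
  hclass z = hclass z' -> deq (dmap (rep_map z)) (dmap (rep_map z')).
Proof.
move=> /hclass_eq [v vE].
pose b := cycle_lin (-1) z' z.
have b0 : deq (dmap (rep_map b)) (dzero rep Y).
  by apply: (@rep_map_boundary _ v); rewrite -vE /= scaleN1r addrC.
apply: (@deq_trans _ _ _ _ _ (dmap (cm_add (rep_map b) (rep_map z')))).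
  apply/deq_map/rep_cmap_ext.
  rewrite -[RHS]/(rep_map b 0 c _ + rep_map z' 0 c _) !rep_mapE /=.
  by rewrite scaleN1r addrAC addNr add0r.
apply: deq_trans (deq_map_add _ _) _.
apply: deq_trans (deq_add b0 (deq_refl _)) _.
exact: deq_add0.
Qed.

(** The Yoneda lemma, by induction on the formal morphism. In the case of the inverse of [s], the
    cycle [z] is homologous to the image of [w] under [s], so [rep_map z] factors through [s] and
    the inverse cancels. *)
Lemma dcomp_rep_map X Y (f : dhom X Y) (z : cycle X 0 c) (w : cycle Y 0 c) :
  hmap f 0 c (hclass z) = hclass w ->
  deq (dcomp f (dmap (rep_map z))) (dmap (rep_map w)).
Proof.
elim: f z w => {X Y} [X Y f|X Y s qs|X Y Z g IHg f IHf|X Y f IHf g IHg] z w.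
- rewrite -[hmap _ _ _ _]/(homology_map f 0 c _) homology_mapE => fz.
  apply: deq_trans (deq_sym (deq_map_comp f (rep_map z))) _.
  apply: deq_trans (rep_map_homologous fz).
  apply/deq_map/rep_cmap_ext; rewrite rep_mapE.
  by rewrite -[LHS]/(f 0 c (rep_map z 0 c _)) rep_mapE.
- move=> /(congr1 (homology_map s 0 c)); rewrite homology_invK homology_mapE
  => zsw.
  have sw : deq (dmap (rep_map z)) (dcomp (dmap s) (dmap (rep_map w))).
    apply: deq_trans (rep_map_homologous zsw) _.
    apply: deq_trans (deq_map_comp s (rep_map w)).
    apply/deq_map/rep_cmap_ext; rewrite rep_mapE.
    by rewrite -[RHS]/(s 0 c (rep_map w 0 c _)) rep_mapE.
  apply: deq_trans (deq_comp (deq_refl _) sw) _.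
  apply: deq_trans (deq_compA _ _ _) _.
  apply: deq_trans (deq_comp (deq_invl qs) (deq_refl _)) _.
  exact: deq_idl.
- have [v fz] := hclass_surj (hmap f 0 c (hclass z)).
  move=> gfz; have gv : hmap g 0 c (hclass v) = hclass w by rewrite -gfz -fz.
  apply: deq_trans (deq_sym (deq_compA _ _ _)) _.
  apply: deq_trans (deq_comp (deq_refl _) (IHf _ _ fz)) _.
  exact: IHg.
- have [u fz] := hclass_surj (hmap f 0 c (hclass z)).
  have [v gz] := hclass_surj (hmap g 0 c (hclass z)).
  have uv : hclass (cycle_lin 1 u v) = hclass u + hclass v.
    by rewrite (hclass_lin (c := 1) (x := u) (y := v)) // scale1r.
  move=> fgz; have {}fgz : hclass (cycle_lin 1 u v) = hclass w.
    by rewrite uv -fgz -fz -gz.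
  apply: deq_trans (deq_compDl _ _ _) _.
  apply: deq_trans (deq_add (IHf _ _ fz) (IHg _ _ gz)) _.
  apply: deq_trans (deq_sym (deq_map_add _ _)) _.
  apply: deq_trans (rep_map_homologous fgz).
  apply/deq_map/rep_cmap_ext; rewrite rep_mapE.
  by rewrite -[LHS]/(rep_map u 0 c _ + rep_map v 0 c _) !rep_mapE /= scale1r.
Qed.

Notation rep_class := (hclass (rep_cycle (idh c))).

Lemma dhom_rep Y (f : dhom rep Y) (w : cycle Y 0 c) :
  hmap f 0 c rep_class = hclass w -> deq f (dmap (rep_map w)).
Proof.
move=> /dcomp_rep_map fw; apply: deq_trans fw.
apply: deq_trans (deq_sym (deq_idr _)) _.
apply: deq_comp (deq_refl _) _.
by apply/deq_map/rep_cmap_ext; rewrite rep_mapE.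
Qed.

Lemma dhom_rep_inj Y (f g : dhom rep Y) :
  hmap f 0 c rep_class = hmap g 0 c rep_class -> deq f g.
Proof.
have [w gw] := hclass_surj (hmap g 0 c rep_class).
rewrite gw => /dhom_rep fw; apply: deq_trans fw _; exact/deq_sym/dhom_rep.
Qed.

Section Sums.
Variables (I : Type) (Y : I -> complex k (fullsub U)).

Definition sum_proj n a i : {linear sum_complex Y n a -> Y i n a} :=
  dirsum_proj (fun i => Y i n a) i.

Lemma sum_proj_cd n m a i t : sum_proj m a i (cd (sum_complex Y) n m a t)
  = cd (Y i) n m a (sum_proj n a i t).
Proof.
move: t; apply: (@sum_ext _ _ _ _ _ _ _ (sum_proj m a i \o cd (sum_complex Y)
  n m a)%R
  (cd (Y i) n m a \o sum_proj n a i)%R) => l x.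
rewrite -[LHS]/(sum_proj m a i (sum_lift (fun l => cd (Y l) n m a) (sum_in
  x))) sum_liftE.
rewrite -[RHS]/(cd (Y i) n m a (sum_proj n a i (sum_in x))).
rewrite -![sum_in _]/(dirsum_in _) /sum_proj.
have [li|li] := pselect (l = i); first by subst l; rewrite !dirsum_projK.
by rewrite !dirsum_proj_neq// linear0.
Qed.

Lemma hmap_dsum (s : seq {classic I}) (f : forall i, dhom rep (Y i))
    (w : forall i, cycle (Y i) 0 c) :
    (forall i, hmap (f i) 0 c rep_class = hclass (w i)) ->
  exists v : cycle (sum_complex Y) 0 c,
    hmap (dsum s f) 0 c rep_class = hclass v /\
    sval v = \sum_(i <- s) sum_in (sval (w i)).
Proof.
move=> fw; elim: s => [|i s [v [fv vE]]].
  exists (cycle0 _ _ _); rewrite big_nil; split=> //.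
  by rewrite [LHS]hmap_dzero; apply/esym/hclass_eq0; exact: boundary0.
exists (cycle_lin 1 (cycle_map (sum_incl Y i) (w i)) v); split; last first.
  by rewrite big_cons -vE /= scale1r.
rewrite -[LHS]/(homology_map (sum_incl Y i) 0 c (hmap (f i) 0 c _) + hmap
  (dsum s f) 0 c _).
rewrite fw fv homology_mapE.
rewrite -[X in X + _]scale1r; exact/esym/hclass_lin.
Qed.

End Sums.

Lemma dirsum_proj_sum (I : Type) (V : I -> lmodType k) (s : seq {classic I})
    (x : forall i, V i) (i : {classic I}) :
  uniq s -> i \in s -> dirsum_proj V i (\sum_(j <- s) dirsum_in (x j)) = x i.
Proof.
move=> us si; rewrite linear_sum (bigD1_seq i)// dirsum_projK big1 => [|j ji].
  exact: addr0.
by rewrite dirsum_proj_neq//; move/eqP: ji.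
Qed.

(** Allowing every duplicate-free list that contains [s] lets the induction add an index without
    deciding whether it already occurs. *)
Lemma dirsum_decomposition (I : Type) (V : I -> lmodType k) (u : dirsum V) :
  exists s : seq {classic I}, forall s' : seq {classic I},
    uniq s' -> {subset s <= s'} ->
    u = \sum_(i <- s') dirsum_in (dirsum_proj V i u).
Proof.
move: u; apply: pres_ind => [|a [i x] u [s sP]].
  exists [::] => s' _ _; rewrite big1// => i _.
  by rewrite linear0 dirsum_in0.
exists ((i : {classic I}) :: s) => s' us' ss'.
have {}sP := sP s' us' (fun j js => ss' j (mem_behead (s := _ :: s) js)).
have si : (i : {classic I}) \in s' by apply: ss'; exact: mem_head.
under eq_bigr do rewrite linearP dirsum_in_linear.
rewrite big_split -sP; congr (_ + _).
rewrite -scaler_sumr -[pgen _ _]/(dirsum_in x); congr (_ *: _).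
rewrite (bigD1_seq (i : {classic I}))// dirsum_projK big1 => [|j ji].
  exact/esym/addr0.
rewrite dirsum_proj_neq ?dirsum_in0//; move/eqP: ji => ji ij.
by apply: ji; rewrite ij.
Qed.

(** Morphisms out of [rep] are classes in H_0 at [c]. A cycle in a direct sum has finitely many
    nonzero components, each a cycle, and a boundary projects to boundaries. *)
Lemma rep_compact : compact_object (rep : derived k (fullsub U)).
Proof.
move=> I Y; split=> [h|s f us fs0 i si].
  have [w hw] := hclass_surj (hmap h 0 c rep_class).
  have wZ i j : cd (Y i) 0 j c (sum_proj Y 0 c i (sval w)) = 0.
    by rewrite -sum_proj_cd (proj2_sig w) linear0.
  pose wi i : cycle (Y i) 0 c :=
    exist (fun x : Y i 0 c => forall j, cd (Y i) 0 j c x = 0) _ (wZ i).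
  have [s sP] := dirsum_decomposition (sval w).
  exists (undup s), (fun i => dmap (rep_map (wi i))); rewrite undup_uniq;
    split=> //.
  apply: dhom_rep_inj.
  have [|v [-> vE]] := @hmap_dsum _ Y (undup s) (fun i => dmap (rep_map (wi
    i))) wi.
    move=> i; rewrite -[LHS]/(homology_map (rep_map (wi i)) 0 c _)
      homology_mapE.
    by congr hclass; apply: cycle_inj; exact: rep_mapE.
  rewrite hw; congr hclass; apply: cycle_inj; rewrite vE.
  apply: sP; first exact: undup_uniq.
  by move=> i; rewrite mem_undup.
have [w fw] : exists w : forall i, cycle (Y i) 0 c,
    forall i, hmap (f i) 0 c rep_class = hclass (w i).
  exists (fun i => projT1 (cid (hclass_surj (hmap (f i) 0 c rep_class)))) => j.
  exact: (projT2 (cid (hclass_surj (hmap (f j) 0 c rep_class)))).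
have [v [fv vE]] := hmap_dsum s fw.
apply: dhom_rep_inj; rewrite fw [RHS]hmap_dzero; apply/hclass_eq0.
have /hclass_eq0 [y yE] : hclass v = 0.
  by rewrite -fv (hmap_deq fs0); exact: hmap_dzero.
rewrite -(dirsum_proj_sum (V := fun i => Y i 0 c) (fun i => sval (w i)) us si).
rewrite -[\sum_(j <- s) _]vE yE -[dirsum_proj _ _ _]/(sum_proj Y 0 c i _)
  sum_proj_cd.
exact: cd_boundary.
Qed.

End Representable.

(** * Injectivity *)

Section RepresentablePrime.
Variables (k : fieldType) (U : finGrp -> Prop) (c : fullsub U).

Definition rep_object : derived_compact k (fullsub U) :=
  exist _ (rep k c : derived k (fullsub U)) (@rep_compact k U c).

(** The augmentation sends every generator to 1. *)
Lemma rep_gen_neq0 a (u : hom a c) : rep_gen k u <> 0.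
Proof.
have aug (j : unit) (v v' : hom a c) (e : (0 : int) = 0) :
  v =h v' -> 1 = 1 :> k^o by [].
move=> /(congr1 (free_lift (b := fun _ _ _ => 1) aug)).
rewrite linear0 [LHS]free_liftE => /eqP; by rewrite oner_eq0.
Qed.

Lemma rep_pmapE a b (f : hom a b) (u : hom b c) :
  pmap (rep k c 0) f (rep_gen k u) = rep_gen k (u \oh f).
Proof. exact: free_pmapE. Qed.

(** Differentials of [rep] vanish, so a class dies only if it restricts to 0, which a generator
    never does. If [G] has no open-kernel surjection onto [c], then neither do its quotients surject
    onto [c], and the modules are 0 there. *)
Lemma group_prime_rep (G : topologicalGroupType) :
  in_profinite_extension U G ->
  group_prime G rep_object <->
  ~ exists phi : epi G (sval c), open (epi_ker phi).
Proof.
move=> GU; rewrite (group_prime_hvanishes GU);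
  split=> [v [phi ophi]|nphi n q x _].
  have [|q [r [_ [y]]]] := v 0 (@UQuotient U G c phi ophi) (rep_gen k (idh c)).
    by move=> j; exact: rep_cd.
  rewrite rep_cd rep_pmapE; exact: rep_gen_neq0.
have -> : x = 0.
  move: x; apply: (@free_ext _ _ _ _ _ _ _ _ idfun \0) => j u e.
  case: nphi; exists (epi_comp u (uq_proj q)).
  exact: (epi_preimage_open [set d | u d = 1%g] (uq_open q)).
by exists q, (idh _); split=> //; rewrite linear0; exact: boundary0.
Qed.

End RepresentablePrime.

Lemma inner_epi (K : groupType) (h : K) :
  exists phi : epi K K, forall x, phi x = (x ^ h)%g.
Proof.
have hM x y : ((x * y) ^ h)%g = (x ^ h * y ^ h)%g by rewrite conjMg.
have hS y : exists x, (x ^ h)%g = y by exists (y ^ h^-1)%g; rewrite conjgKV.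
by exists (Epi hM hS).
Qed.

Lemma hvanishes_transport (k : fieldType) (U : finGrp -> Prop)
    (G H : topologicalGroupType) (f : cepi G H) (g : cepi H G)
    (X : complex k (fullsub U)) :
  epi_conj (epi_comp f g) (epi_id H) -> hvanishes G X -> hvanishes H X.
Proof.
move=> [h fg] vX n q x xZ.
have oqf : open (epi_ker (epi_comp (uq_proj q) f)).
  rewrite (_ : epi_ker _ = f @^-1` epi_ker (uq_proj q)) //.
  by apply: open_comp (uq_open q) => y _; exact: cepi_continuous.
have [q1 [r [rq bx]]] := vX n (UQuotient oqf) x xZ.
(* [f] and [g] are inverse only up to conjugation by [h], whereas [uq_over] is strict; conjugating
   the projection by a lift [c] of the image of [h] corrects this. *)
have [c rc] := epi_surj r (uq_proj q h).
have [phi phiE] := inner_epi c.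
have oq1 : open (epi_ker (epi_comp phi (epi_comp (uq_proj q1) g))).
  rewrite (_ : epi_ker _ = g @^-1` [set y | phi (uq_proj q1 y) = 1%g]) //.
  apply: open_comp; first by move=> y _; exact: cepi_continuous.
  exact: (epi_preimage_open [set d | phi d = 1%g] (uq_open q1)).
exists (UQuotient oq1), r; split=> // y.
by rewrite -[LHS]/(r (phi (uq_proj q1 (g y)))) phiE epiJ rc rq /= -epiJ -fg.
Qed.

Lemma hvanishes_isog (k : fieldType) (U : finGrp -> Prop)
    (G H : profinite_extension U) (X : complex k (fullsub U)) :
  iso G H -> hvanishes (sval G) X = hvanishes (sval H) X.
Proof.
move=> [f [g [gf fg]]]; apply/propext; split.
  exact: hvanishes_transport fg.
exact: hvanishes_transport gf.
Qed.

Lemma sval_injective (T : Type) (P : T -> Prop) : injective (@sval T P).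
Proof. by move=> [x Px] [y Py] /= xy; apply: eq_exist. Qed.

Lemma iso_refl (C : category) (a : C) : iso a a.
Proof. by exists (idh a), (idh a); split; exact: comph_idl. Qed.

Lemma iso_sym (C : category) (a b : C) : iso a b -> iso b a.
Proof. by move=> [f [g [gf fg]]]; exists g, f. Qed.

Lemma iso_trans (C : category) (a b c : C) : iso a b -> iso b c -> iso a c.
Proof.
move=> [f [g [gf fg]]] [f' [g' [gf' fg']]]; exists (f' \oh f), (g \oh g').
split.
  apply: eqh_trans gf; apply: eqh_trans (comphA _ _ _) _.
  apply: comph_eq (eqh_refl _).
  apply: eqh_trans (eqh_sym (comphA _ _ _)) _.
  by apply: eqh_trans (comph_idr g); apply: comph_eq (eqh_refl _) gf'.
apply: eqh_trans fg'; apply: eqh_trans (comphA _ _ _) _.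
apply: comph_eq (eqh_refl _).
apply: eqh_trans (eqh_sym (comphA _ _ _)) _.
by apply: eqh_trans (comph_idr f'); apply: comph_eq (eqh_refl _) fg.
Qed.

Theorem proposition12p4 (k : fieldType) (U : finGrp -> Prop)
    (k_char0 : [pchar k] =i pred0)
    (U_replete : replete U)
    (U_widely_closed : widely_closed U)
    (unit_compact : compact_object (unit_complex k (fullsub U)))
    (U_filtration : exists V : nat -> finGrp -> Prop,
       profinite_reflective_filtration U V) :
  exists p : pi0 (profinite_extension U) -> Spc k (fullsub U),
    (forall G : profinite_extension U,
       sval (p (pi0_class G)) = group_prime (sval G)) /\
    injective p.
Proof.
pose rpr (a : pi0 (profinite_extension U)) := projT1 (cid (proj2_sig a)).
have rprE a : sval a = iso (rpr a) := projT2 (cid (proj2_sig a)).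
exists (fun a => exist _ (group_prime (sval (rpr a)))
  (group_prime_ideal (proj2_sig (rpr a)) unit_compact));
    split=> [G /=|a b [ab]].
  (* Independence of the chosen representative of the isomorphism class. *)
  have GrG : iso G (rpr (pi0_class G)).
    by rewrite -[iso G _]/(sval (pi0_class G) _) rprE; exact: iso_refl.
  apply/funext => X; rewrite !(group_prime_hvanishes (proj2_sig _)).
  exact/esym/hvanishes_isog.
have ab_iso : iso (rpr a) (rpr b).
  apply: iso_of_same_quotients => Q.
  (* Equal primes contain the same representables, which recovers the quotients in [U]. *)
  have := congr1 (fun P : derived_compact k (fullsub U) ->
    Prop => P (rep_object k Q)) ab.
  rewrite /= => /propeqP abQ.
  have nab : ~ (exists phi : epi (sval (rpr a)) (sval Q),
    open (epi_ker phi)) <->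
             ~ (exists phi : epi (sval (rpr b)) (sval Q), open (epi_ker phi)).
    by rewrite -!(group_prime_rep k Q (proj2_sig _)).
  by split=> ex; apply: contrapT => /nab; apply.
apply: sval_injective; rewrite !rprE; apply/funext => c; apply/propext.
split=> [ac|bc]; first exact: iso_trans (iso_sym ab_iso) ac.
exact: iso_trans ab_iso bc.
Qed.
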